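(* Let $\tau>0$, $\xi\in[t_0,t_0+\tau]$, $\eta\in\mathbb R^m$, and let $y(t)\equiv y(t,\xi,\eta,\phi;t_0)$ be the solution of $$\dot y(t)=f(y(t),y(t-\tau)),\quad t\in[t_0,t_0+\tau],\qquad y(\xi)=\eta,\qquad y(t)=\phi(t),\quad t\in[t_0-\tau,t_0).$$ Then, for any $\hat t\in(\xi-\tau,t_0)$, the functional derivative of $y$ with respect to $\phi$ at $\hat t$ is $$\frac{\delta}{\delta\phi(\hat t\,)}y(t)=\Psi(t,\hat t\,;t_0),$$ where $\Psi(t,\hat t\,;t_0)$ satisfies $$\dot\Psi(t,\hat t\,;t_0)=F_1(y(t),y(t-\tau))\,\Psi(t,\hat t\,;t_0),\qquad t\in(\hat t+\tau,t_0+\tau],$$ $$\Psi(\hat t+\tau,\hat t\,;t_0)=F_2(y(\hat t+\tau),y(\hat t\,)),$$ $$\Psi(t,\hat t\,;t_0)=\delta_{\hat t}(t)\,I,\qquad t\in[t_0-\tau,\hat t+\tau),$$ with $I\in\mathbb R^{m\times m}$ the identity matrix and $\delta_{\hat t}(t)$ the Dirac delta function centered at $\hat t$.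
   Context: $f:\mathbb R^m\times\mathbb R^m\to\mathbb R^m$, $(z,w)\mapsto f(z,w)$, and $\phi:[t_0-\tau,t_0]\to\mathbb R^m$ are assumed suitably regular (as smooth as needed); $F_1(z,w)=\frac{\partial}{\partial z}f(z,w)$ and $F_2(z,w)=\frac{\partial}{\partial w}f(z,w)$. The dot denotes differentiation in $t$. The solution is taken to be defined on the whole of $[t_0,t_0+\tau]$ (on both sides of $\xi$), and $y(t-\tau)=\phi(t-\tau)$ for $t\in[t_0,t_0+\tau]$. The functional derivative $\frac{\delta}{\delta\phi(\zeta)}y(t)=\left(\frac{\delta}{\delta\phi_j(\zeta)}y_i(t)\right)\in\mathbb R^{m\times m}$, $(t,\zeta)\in[t_0-\tau,t_0+\tau]\times[t_0-\tau,t_0)$, is the kernel (in the generalized, distributional sense) such that for any perturbation $\delta\phi\in C([t_0-\tau,t_0])$ and $t\in[t_0-\tau,t_0+\tau]$ $$\lim_{\varepsilon\to0}\frac{y(t,\xi,\eta,\phi+\varepsilon\,\delta\phi;t_0)-y(t,\xi,\eta,\phi;t_0)}{\varepsilon}=\int_{t_0-\tau}^{t_0}\frac{\delta}{\delta\phi(\zeta)}y(t)\,\delta\phi(\zeta)\,d\zeta ,$$ and, for given $\hat t\in[t_0-\tau,t_0)$, with $e_j$ the $j$th unit vector and $\delta_{\hat t}$ the Dirac delta function centered at $\hat t$, formally $$\frac{\delta}{\delta\phi_j(\hat t\,)}y_i(t)=\lim_{\varepsilon\to0}\frac{y_i(t,\xi,\eta,\phi+\varepsilon e_j\delta_{\hat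 t};t_0)-y_i(t,\xi,\eta,\phi;t_0)}{\varepsilon}.$$ *)

(* Defs.v *)
From HB Require Import structures.
From mathcomp Require Import all_boot all_order all_algebra.
From mathcomp Require Import all_classical all_reals all_analysis.

Set Implicit Arguments.
Unset Strict Implicit.
Unset Printing Implicit Defensive.

Import Order.TTheory GRing.Theory Num.Theory.
Import numFieldNormedType.Exports.

Local Open Scope classical_set_scope.
Local Open Scope ring_scope.

(* R^m is 'cV[R]_m.  The library's [jacobian] is for row vectors (acting on the
   right), hence this column-vector version. *)
Definition jac (R : realType) (m : nat) (g : 'cV[R]_m -> 'cV[R]_m)
    (a : 'cV[R]_m) : 'M[R]_m :=
  \matrix_(i < m, j < m) ('D_(delta_mx j 0) g a) i 0.

Definition F1 (R : realType) (m : nat) (f : 'cV[R]_m -> 'cV[R]_m -> 'cV[R]_m)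
    (z w : 'cV[R]_m) : 'M[R]_m :=
  jac (fun z' => f z' w) z.

Definition F2 (R : realType) (m : nat) (f : 'cV[R]_m -> 'cV[R]_m -> 'cV[R]_m)
    (z w : 'cV[R]_m) : 'M[R]_m :=
  jac (fun w' => f z w') w.

Definition C1 (R : realType) (m : nat)
    (f : 'cV[R]_m -> 'cV[R]_m -> 'cV[R]_m) : Prop :=
  [/\ forall p : 'cV[R]_m * 'cV[R]_m,
        differentiable (fun q : 'cV[R]_m * 'cV[R]_m => f q.1 q.2) p,
      continuous (fun q : 'cV[R]_m * 'cV[R]_m => F1 f q.1 q.2) &
      continuous (fun q : 'cV[R]_m * 'cV[R]_m => F2 f q.1 q.2)].

(* Derivative relative to D: two-sided in the interior of an interval D,
   one-sided at those endpoints that belong to D. *)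
Definition is_derive_within (R : realType) (V : normedModType R) (D : set R)
    (u : R -> V) (t : R) (l : V) : Prop :=
  (fun s : R => (s - t)^-1 *: (u s - u t)) @ within D t^' --> l.

(* The delayed term y (t - tau) is phi (t - tau) on the whole of [t0, t0 + tau].
   This matters at t = t0 + tau only: there y t0 may differ from phi t0. *)
Definition is_solution (R : realType) (m : nat)
    (f : 'cV[R]_m -> 'cV[R]_m -> 'cV[R]_m) (t0 tau xi : R) (eta : 'cV[R]_m)
    (phi : R -> 'cV[R]_m) (y : R -> 'cV[R]_m) : Prop :=
  [/\ forall t : R, t \in `[t0, t0 + tau] ->
        is_derive_within `[t0, t0 + tau] y t (f (y t) (phi (t - tau))),
      y xi = eta &
      forall t : R, t \in `[t0 - tau, t0[ -> y t = phi t].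

(* [GenVal A C] is the value A + C * delta_zeta(t) of a generalized
   matrix kernel at a point (t, zeta). *)
Record genval (R : realType) (m : nat) : Type :=
  GenVal { regular_part : 'M[R]_m ; delta_part : 'M[R]_m }.

Definition regular (R : realType) (m : nat) (A : 'M[R]_m) : genval R m :=
  GenVal A 0.

(* delta_zeta(t) * I *)
Definition delta_id (R : realType) (m : nat) : genval R m :=
  GenVal 0 1%:M.

Definition genkernel (R : realType) (m : nat) : Type := R -> R -> genval R m.

(* The integral over [a, b[ of K(t, zeta) * v(zeta) d zeta: as a distribution in
   zeta, delta_zeta(t) is the unit point mass at t. *)
Definition pairing (R : realType) (m : nat) (K : genkernel R m) (a b t : R)
    (v : R -> 'cV[R]_m) : 'cV[R]_m :=
  \col_(i < m)
    (\int[lebesgue_measure]_(zeta in `[a, b[)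
        ((regular_part (K t zeta) *m v zeta) i 0)
     + \int[\d_t]_(zeta in `[a, b[)
        ((delta_part (K t zeta) *m v zeta) i 0)).

Definition integrable_kernel (R : realType) (m : nat) (K : genkernel R m)
    (a b t : R) : Prop :=
  forall i j : 'I_m,
    lebesgue_measure.-integrable `[a, b[
      (fun zeta : R => (regular_part (K t zeta) i j)%:E) /\
    (\d_t).-integrable `[a, b[
      (fun zeta : R => (delta_part (K t zeta) i j)%:E).

(* K is the functional derivative at phi of the solution
   phi |-> y(., xi, eta, phi; t0).  The first clause on dphi says that the
   perturbed solutions entering the difference quotient exist. *)
Definition is_functional_derivative (R : realType) (m : nat)
    (f : 'cV[R]_m -> 'cV[R]_m -> 'cV[R]_m) (t0 tau xi : R) (eta : 'cV[R]_m)
    (phi y : R -> 'cV[R]_m) (K : genkernel R m) : Prop :=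
  (forall t : R, t \in `[t0 - tau, t0 + tau] ->
     integrable_kernel K (t0 - tau) t0 t) /\
  forall dphi : R -> 'cV[R]_m,
    {within `[t0 - tau, t0], continuous dphi} ->
    (\forall e \near (0 : R)^', exists z : R -> 'cV[R]_m,
       is_solution f t0 tau xi eta (fun s => phi s + e *: dphi s) z) /\
    forall Y : R -> R -> 'cV[R]_m,
      (\forall e \near (0 : R)^',
         is_solution f t0 tau xi eta (fun s => phi s + e *: dphi s) (Y e)) ->
      forall t : R, t \in `[t0 - tau, t0 + tau] ->
        (fun e : R => e^-1 *: (Y e t - y t)) @ (0 : R)^'
          --> pairing K (t0 - tau) t0 t dphi.

(* The problem defining Psi(., that; t0).  Continuity on the closed interval
   makes the initial condition at that + tau effective, as the equation is
   imposed to the right of that point only. *)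
Definition is_Psi (R : realType) (m : nat)
    (f : 'cV[R]_m -> 'cV[R]_m -> 'cV[R]_m) (t0 tau : R)
    (phi y : R -> 'cV[R]_m) (that : R) (Psi : R -> genval R m) : Prop :=
  (exists U : R -> 'M[R]_m,
     [/\ forall t : R, t \in `[that + tau, t0 + tau] -> Psi t = regular (U t),
         {within `[that + tau, t0 + tau], continuous U},
         forall t : R, t \in `]that + tau, t0 + tau] ->
           is_derive_within `[that + tau, t0 + tau] U t
             (F1 f (y t) (phi (t - tau)) *m U t) &
         U (that + tau) = F2 f (y (that + tau)) (y that)]) /\
  (forall t : R, t \in `[t0 - tau, that + tau[ -> Psi t = delta_id R m).

(* Main.v *)
Require Import Defs.
From HB Require Import structures.
From mathcomp Require Import all_boot all_order all_algebra.
From mathcomp Require Import all_classical all_reals all_analysis.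
From mathcomp Require Import measurable_realfun ring lra.
Import Order.TTheory GRing.Theory Num.Theory.
Import numFieldNormedType.Exports.
Local Open Scope classical_set_scope.
Local Open Scope ring_scope.

(** On [t0, t0 + tau] the delayed argument y (t - tau) is the given history
    phi (t - tau). The delay equation is therefore an ordinary differential
    equation with a time-dependent input, with a value prescribed at xi, and the
    functional derivative with respect to phi is the derivative of its solution
    with respect to the input.

    Replace phi by phi + e dphi. The linearized equation for the first-order
    change delta of the solution is
    delta' (t) = A(t) delta(t) + B(t) dphi(t - tau), delta(xi) = 0,
    where A and B are the values of F1 and F2 along (y(t), phi(t - tau)). With a
    fundamental matrix X of the homogeneous equation and its inverse Y
    ([fundamental_matrix]), the variation of constants formula reads
    delta(t) = integral from xi to t of X(t) Y(s) B(s) dphi(s - tau) ds.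
    Substituting s = z + tau shows that the kernel at (t, z) is
    X(t) Y(z + tau) B(z + tau) for z between xi - tau and t - tau, with the
    opposite sign when t < xi. For fixed z > xi - tau, as a function of t, it solves the homogeneous linear equation and equals B(z + tau) at
    t = z + tau, which is the problem defining Psi. For t < t0 the solution is the
    history, whose derivative is a unit point mass at t.

    The analytic content is that delta is the limit of the difference quotients.
    First, perturbed solutions exist on the whole interval and differ from y by
    O(e) ([perturbed_solution]), by global existence for Lipschitz equations
    ([picard]) applied to a truncation of f, and they are unique
    ([solution_unique]), so that the estimate holds for any family of perturbed
    solutions. Then the expansion of f along the curve (y(t), phi(t - tau)) has a
    remainder that is small uniformly in time ([uniform_linearization]), and the
    Gronwall inequality shows that the quotients converge
    ([solution_derivative]). Finally, the pairing of the kernel with dphi is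
    computed by the fundamental theorem of calculus ([pairing_past],
    [pairing_future]). *)

Set Implicit Arguments.
Unset Strict Implicit.
Unset Printing Implicit Defensive.

(** * Matrix-valued functions and extension of functions from a segment *)

Section Matrices.
Context {R : realType}.

Lemma mx_norm_entry p q (A : 'M[R]_(p, q)) i j : `|A i j| <= `|A|.
Proof.
rewrite [leRHS]/Num.Def.normr/= mx_normrE.
exact: (le_bigmax _ (fun ij : 'I_p * 'I_q => `|A ij.1 ij.2|) (i, j)).
Qed.

Lemma mx_norm_le p q (A : 'M[R]_(p, q)) c :
  0 <= c -> (forall i j, `|A i j| <= c) -> `|A| <= c.
Proof.
move=> c0 Ac; rewrite [leLHS]/Num.Def.normr/= mx_normrE.
by apply: bigmax_le => // -[i j] _; exact: Ac.
Qed.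

Lemma mulmx_entry_le p q r (A : 'M[R]_(p, q)) (B : 'M[R]_(q, r)) c i j :
  0 <= c -> (forall i j, `|A i j| <= c) -> `|(A *m B) i j| <= q%:R * c * `|B|.
Proof.
move=> c0 Ac; rewrite mxE (le_trans (ler_norm_sum _ _ _))//.
have -> : q%:R * c * `|B| = \sum_(k < q) c * `|B|.
  by rewrite sumr_const card_ord -mulrA mulr_natl.
by apply: ler_sum => k _; rewrite normrM ler_pM// mx_norm_entry.
Qed.

Lemma mulmx_entry_ler p q r (A : 'M[R]_(p, q)) (B : 'M[R]_(q, r)) c i j :
  0 <= c -> (forall i j, `|B i j| <= c) -> `|(A *m B) i j| <= q%:R * c * `|A|.
Proof.
move=> c0 Bc; rewrite mxE (le_trans (ler_norm_sum _ _ _))//.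
have -> : q%:R * c * `|A| = \sum_(k < q) c * `|A|.
  by rewrite sumr_const card_ord -mulrA mulr_natl.
by apply: ler_sum => k _; rewrite normrM mulrC ler_pM// mx_norm_entry.
Qed.

(** Finitely many entries, so eventual closeness of each of them is eventual
    closeness in the max norm; this holds along any filter, which is what makes
    it usable for limits within a set as well. *)
Lemma cvg_mx T (F : set_system T) (FF : Filter F) p q
    (u : T -> 'M[R]_(p, q)) (l : 'M[R]_(p, q)) :
  (forall i j, u x i j @[x --> F] --> l i j) -> u @ F --> l.
Proof.
move=> ul; apply/cvgrPdist_le => e e0; near=> x.
apply: mx_norm_le (ltW e0) _ => i j; rewrite !mxE.
move: i j; near: x; apply: filter_forall => i; apply: filter_forall => j.
by move/cvgrPdist_le: (ul i j); exact.
Unshelve. all: by end_near. Qed.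

Lemma cvg_entry T (F : set_system T) (FF : Filter F) p q
    (u : T -> 'M[R]_(p, q)) (l : 'M[R]_(p, q)) i j :
  u @ F --> l -> u x i j @[x --> F] --> l i j.
Proof. by move=> ul; exact: (cvg_comp _ _ ul (@coord_continuous _ _ _ i j l)). Qed.

Lemma cvg_mulmx T (F : set_system T) (FF : Filter F) p q r
    (u : T -> 'M[R]_(p, q)) (v : T -> 'M[R]_(q, r))
    (A : 'M[R]_(p, q)) (B : 'M[R]_(q, r)) :
  u @ F --> A -> v @ F --> B -> u x *m v x @[x --> F] --> A *m B.
Proof.
move=> uA vB; apply: cvg_mx => i j; rewrite mxE.
under eq_fun do rewrite mxE.
apply: cvg_big => [|k _]; first exact: add_continuous.
by apply: cvgM; exact: cvg_entry.
Qed.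

Lemma is_derive_mxP p q (u : R -> 'M[R]_(p, q)) (t : R) (l : 'M[R]_(p, q)) :
  is_derive t 1 u l <-> forall i j, is_derive t 1 (fun s => u s i j) (l i j).
Proof.
split=> [[du <-] i j|ul].
  split; first exact: (derivable_mxP _ _ _).1.
  by rewrite derive_mx// mxE.
have du : derivable u t 1 by apply/derivable_mxP => i j; case: (ul i j).
split=> //; rewrite derive_mx//; apply/matrixP => i j; rewrite mxE.
by case: (ul i j).
Qed.

Lemma is_derive_bigsum n (h : 'I_n -> R -> R) (t : R) (dh : 'I_n -> R) :
  (forall i, is_derive t 1 (h i) (dh i)) ->
  is_derive t 1 (fun s => \sum_(i < n) h i s) (\sum_(i < n) dh i).
Proof.
move=> hd; have := is_derive_sum hd.
by congr is_derive; apply/funext => s; rewrite fct_sumE.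
Qed.

Lemma is_derive_mulmx p q r (u : R -> 'M[R]_(p, q)) (v : R -> 'M[R]_(q, r))
    (t : R) du dv :
  is_derive t 1 u du -> is_derive t 1 v dv ->
  is_derive t 1 (fun s => u s *m v s) (du *m v t + u t *m dv).
Proof.
move=> /is_derive_mxP ud /is_derive_mxP vd; apply/is_derive_mxP => i j.
under eq_fun do rewrite mxE.
have H k : is_derive t 1 (fun s => u s i k * v s k j)
    (du i k * v t k j + u t i k * dv k j).
  have := is_deriveM (ud i k) (vd k j) => /is_derive_eq; apply.
  by rewrite /GRing.scale /=; ring.
apply: is_derive_eq; first exact: (is_derive_bigsum H).
by rewrite !mxE -big_split.
Qed.

Lemma is_derive_cts (V : normedModType R) (u : R -> V) (t : R) l :
  is_derive t 1 u l -> {for t, continuous u}.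
Proof.
by move=> [/derivable1_diffP + _]; exact: differentiable_continuous.
Qed.

End Matrices.

Section Clamp.
Context {R : realType}.
Implicit Types a b t : R.

(** Precomposing with the retraction of the line onto a segment turns a function
    continuous on the segment into one continuous on the whole line, so
    that coefficients and inputs can be differentiated or integrated without
    endpoint conditions. *)
Definition clamp a b t : R := Num.max a (Num.min b t).

Lemma clamp_in a b t : a <= b -> clamp a b t \in `[a, b].
Proof.
by move=> ab; rewrite in_itv/= /clamp le_max lexx/= ge_max ab ge_min lexx.
Qed.

Lemma clamp_id a b t : t \in `[a, b] -> clamp a b t = t.
Proof.
by rewrite in_itv/= => /andP[at_ tb]; rewrite /clamp min_r// max_r.
Qed.

Lemma clamp_dist a b s t : `|clamp a b s - clamp a b t| <= `|s - t|.
Proof.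
have maxd x y : `|Num.max a x - Num.max a y| <= `|x - y|.
  rewrite ler_norml; have := ler_norm (x - y).
  have := lerNnormlW (lexx `|x - y|).
  by case: (leP a x) => ?; case: (leP a y) => ? ? ?; apply/andP; split; lra.
have mind x y : `|Num.min b x - Num.min b y| <= `|x - y|.
  rewrite ler_norml; have := ler_norm (x - y).
  have := lerNnormlW (lexx `|x - y|).
  by case: (leP b x) => ?; case: (leP b y) => ? ? ?; apply/andP; split; lra.
exact: le_trans (maxd _ _) (mind _ _).
Qed.

Lemma clamp_continuous a b : continuous (clamp a b).
Proof.
move=> t; apply/cvgrPdist_le => e e0.
have /cvgrPdist_le/(_ e e0) : (id : R -> R) s @[s --> t] --> t by exact: cvg_id.
by apply: filterS => s; exact: le_trans (clamp_dist _ _ _ _).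
Qed.

Lemma continuous_clamp (V : topologicalType) a b (u : R -> V) : a <= b ->
  {within `[a, b], continuous u} -> continuous (u \o clamp a b).
Proof.
move=> ab uc t P nP.
have cab : clamp a b t \in `[a, b] by exact: clamp_in.
have := uc (clamp a b t); rewrite /continuous_at.
move=> /(_ P nP); rewrite /nbhs/= -nbhs_subspace_in//= => uP.
have ctP := @clamp_continuous a b t _ uP.
apply: (@filterS _ (nbhs t) _ _ _ _ ctP) => s /=; apply; exact: clamp_in.
Qed.

End Clamp.

(** * Primitives of continuous functions *)

Section Primitive.
Context {R : realType}.

Lemma is_derive0_cst_right (f : R -> R) (c x y : R) :
  (forall t, c < t -> is_derive t 1 f 0) -> c < x -> c < y -> f x = f y.
Proof.
move=> f0; wlog xy : x y / x <= y.
  by move=> H cx cy; case: (leP x y) => [/H->//|/ltW/H->].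
move=> cx cy; have [t txy||t _] := @MVT_segment R f (fun=> 0) x y xy.
- by move: txy; rewrite in_itv/= => /andP[xt _]; apply: f0; exact: lt_trans xt.
- apply: continuous_in_subspaceT => z; rewrite inE/= in_itv/= => /andP[xz _].
  by apply: is_derive_cts; apply: f0; exact: lt_le_trans xz.
- by rewrite mul0r => /eqP; rewrite subr_eq0 => /eqP.
Qed.

(** Integrating from a fixed left endpoint gives a primitive to the right of that
    endpoint only. Differences of the values of such a primitive do not depend on
    the endpoint, which may therefore be taken to vary with the argument. *)
Lemma primitive_exists (xi : R) (h : R -> R) : continuous h ->
  exists H : R -> R, H xi = 0 /\ forall t : R, is_derive t 1 H (h t).
Proof.
move=> hc.
pose P c t : R := \int[@lebesgue_measure R]_(s in `[c, t]) h s.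
have Pd (c t : R) : c < t -> is_derive t 1 (P c) (h t).
  move=> ct.
  have [|||| dP P'] := @continuous_FTC1_closed R h c t (t + 1).
  - by rewrite ltrDl.
  - apply: continuous_compact_integrable; first exact: segment_compact.
    exact: continuous_subspaceT.
  - exact: ct.
  - exact: hc.
  by apply: DeriveDef; [exact: dP|rewrite -derive1E; exact: P'].
(* two such primitives differ by a constant on their common domain *)
have Pdiff (c c' x y : R) : c < x -> c < y -> c' < x -> c' < y ->
    P c x - P c y = P c' x - P c' y.
  move=> cx cy c'x c'y.
  have : (P c - P c') x = (P c - P c') y.
    apply: (@is_derive0_cst_right _ (Num.max c c'));
      rewrite ?gt_max ?cx ?c'x ?cy ?c'y//.
    move=> t; rewrite gt_max => /andP[ct c't].
    have := is_deriveB (Pd _ _ ct) (Pd _ _ c't).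
    by rewrite subrr.
  rewrite !fctE => ?; lra.
exists (fun t => P (Num.min t xi - 1) t - P (Num.min t xi - 1) xi); split.
  by rewrite subrr.
(* this endpoint serves for all arguments within distance 1 of t *)
move=> t; pose c := Num.min t xi - 2.
have ct : c < t.
  by rewrite /c ltrBlDr gt_min ltrDl ltr0n.
have cx : c < xi by rewrite /c ltrBlDr gt_min [X in _ || X]ltrDl ltr0n orbT.
have := is_deriveB (Pd _ _ ct) (is_derive_cst (P c xi) t 1).
rewrite subr0; apply: near_eq_is_derive.
have : \forall s \near t, `|t - s| < 1.
  by have /cvgrPdist_lt/(_ 1 ltr01) : (id : R -> R) s @[s --> t] --> t
    by exact: cvg_id.
apply: filterS => s ts; rewrite !fctE.
have m_t : Num.min t xi <= t by rewrite ge_min lexx.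
have m_s : Num.min s xi <= s by rewrite ge_min lexx.
have m_x : Num.min s xi <= xi by rewrite ge_min lexx orbT.
move: ts; rewrite ltr_norml => /andP[_ ts].
by apply: Pdiff; rewrite // /c; lra.
Qed.

End Primitive.

(** * Differential inequalities *)

Section Comparison.
Context {R : realType}.

Lemma derive_ge0_le (f df : R -> R) (x y : R) : x < y ->
  {within `[x, y], continuous f} ->
  (forall t, t \in `]x, y[ -> is_derive t 1 f (df t)) ->
  (forall t, t \in `]x, y[ -> 0 <= df t) -> f x <= f y.
Proof.
move=> xy fc fd df0; have [z zxy fE] := MVT xy fd fc.
by rewrite -subr_ge0 fE mulr_ge0 ?df0// subr_ge0 ltW.
Qed.

Implicit Types k xi t a b : R.

(** This is 2 cosh (k (t - xi)). Up to a factor k it is the derivative of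
    2 sinh (k (t - xi)), which vanishes at xi. So it plays the role of
    exp (k |t - xi|), without distinguishing the two sides of xi, which may
    lie inside the time interval. *)
Definition weight k xi t : R := expR (k * (t - xi)) + expR (- (k * (t - xi))).

Let sh k xi t : R := expR (k * (t - xi)) - expR (- (k * (t - xi))).

Lemma weight_ge1 k xi t : 1 <= weight k xi t.
Proof.
rewrite /weight; case: (leP 0 (k * (t - xi))) => kt.
  have := expR_ge1Dx (k * (t - xi)).
  by have := expR_ge0 (- (k * (t - xi))); lra.
have := expR_ge1Dx (- (k * (t - xi))).
by have := expR_ge0 (k * (t - xi)); lra.
Qed.

Let is_derive_exp_affine k xi t :
  is_derive t 1 (fun s => expR (k * (s - xi))) (k * expR (k * (t - xi))).
Proof.
have aff : is_derive t (1 : R) (fun s => k * (s - xi)) k.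
  have := is_deriveZ k (is_deriveB (is_derive_id t (1 : R)) (is_derive_cst xi t 1)).
  by rewrite subr0 /GRing.scale /= mulr1.
have := @is_derive1_comp R expR (fun s => k * (s - xi)) t _ _ (is_derive_expR _) aff.
by rewrite mulrC.
Qed.

Let is_derive_sh k xi t : is_derive t 1 (sh k xi) (k * weight k xi t).
Proof.
have := is_deriveB (is_derive_exp_affine k xi t) (is_derive_exp_affine (- k) xi t).
rewrite !mulNr opprK -mulrDr; congr is_derive.
by apply/funext => s; rewrite /sh -mulNr.
Qed.

Lemma weight_continuous k xi : continuous (weight k xi).
Proof.
move=> t.
have -> : weight k xi =
    (fun s => expR (k * (s - xi))) + (fun s => expR (- k * (s - xi))).
  by apply/funext => s; rewrite /weight -mulNr.
exact: is_derive_cts (is_deriveD (is_derive_exp_affine k xi t)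
  (is_derive_exp_affine (- k) xi t)).
Qed.

Lemma weight_le k xi t a b : 0 <= k -> xi \in `[a, b] -> t \in `[a, b] ->
  weight k xi t <= 2 * expR (k * (b - a)).
Proof.
rewrite !in_itv/= => k0 /andP[ax xb] /andP[at_ tb].
have le1 : expR (k * (t - xi)) <= expR (k * (b - a)).
  by rewrite ler_expR ler_wpM2l//; lra.
have le2 : expR (- (k * (t - xi))) <= expR (k * (b - a)).
  by rewrite ler_expR -mulrN ler_wpM2l//; lra.
by rewrite /weight mulr2n mulrDl !mul1r lerD.
Qed.

(** Integrating the bound on the derivative from xi costs a factor 1 / k: both
    differences between A / k times the sinh primitive of the weight and w or - w
    are nondecreasing. A large k thus makes integration a contraction. *)
Lemma comparison a b xi k A (w dw : R -> R) : 0 < k -> 0 <= A ->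
  xi \in `[a, b] -> {within `[a, b], continuous w} ->
  (forall t, t \in `]a, b[ -> is_derive t 1 w (dw t)) ->
  (forall t, t \in `]a, b[ -> `|dw t| <= A * weight k xi t) -> w xi = 0 ->
  forall t, t \in `[a, b] -> `|w t| <= A / k * weight k xi t.
Proof.
move=> k0 A0 xab wc wd dwA w0.
have step (x y : R) : x \in `[a, b] -> y \in `[a, b] -> x < y ->
    `|w y - w x| <= A / k * (sh k xi y - sh k xi x).
  move=> xI yI xy.
  have sub : `]x, y[ `<=` `]a, b[.
    move: xI yI; rewrite !in_itv/= => /andP[ax _] /andP[_ yb] z/=.
    by rewrite !in_itv/= => /andP[xz zy]; 
      rewrite (le_lt_trans ax xz) (lt_le_trans zy yb).
  have subc : `[x, y] `<=` `[a, b].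
    move: xI yI; rewrite !in_itv/= => /andP[ax _] /andP[_ yb] z/=.
    by rewrite !in_itv/= => /andP[xz zy];
      rewrite (le_trans ax xz) (le_trans zy yb).
  have aux (v dv : R -> R) : {within `[a, b], continuous v} ->
      (forall t, t \in `]a, b[ -> is_derive t 1 v (dv t)) ->
      (forall t, t \in `]a, b[ -> dv t <= A * weight k xi t) ->
      v y - v x <= A / k * (sh k xi y - sh k xi x).
    move=> vc vd dvA.
    pose f s := A / k * sh k xi s - v s.
    pose df s := A * weight k xi s - dv s.
    have fc : {within `[x, y], continuous f}.
      have := continuous_subspaceW subc vc.
      have : {within `[x, y], continuous (fun s => A / k * sh k xi s)}.
        apply: continuous_subspaceT => s.
        exact: is_derive_cts (is_deriveZ (A / k) (is_derive_sh k xi s)).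
      by move=> shc vc' s; exact: cvgB (shc s) (vc' s).
    have fd t : t \in `]x, y[ -> is_derive t 1 f (df t).
      move=> /sub tab.
      have := is_deriveB (is_deriveZ (A / k) (is_derive_sh k xi t)) (vd _ tab).
      by rewrite /GRing.scale /= mulrA divfK // gt_eqF.
    have df0 t : t \in `]x, y[ -> 0 <= df t.
      by move=> /sub /dvA; rewrite subr_ge0.
    by have := derive_ge0_le xy fc fd df0; rewrite /f; lra.
  rewrite ler_norml; apply/andP; split.
    rewrite lerNl opprB; have := aux (fun s => - w s) (fun s => - dw s).
    rewrite opprK addrC; apply.
    + by move=> s; exact: cvgN (wc s).
    + by move=> s sab; apply: is_deriveN; exact: wd.
    + by move=> s /dwA; rewrite ler_norml lerNl => /andP[].
  apply: (aux w dw) => // t /dwA; exact: le_trans (ler_norm _).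
have sh0 : sh k xi xi = 0 by rewrite /sh subrr mulr0 oppr0 subrr.
move=> t tab.
have Ak : 0 <= A / k by rewrite divr_ge0// ltW.
have wt0 : 0 <= weight k xi t by apply: le_trans (weight_ge1 _ _ _).
have [xt|tx|<-] := ltgtP xi t; last
  by rewrite w0 normr0 mulr_ge0// (le_trans _ (weight_ge1 _ _ _)).
  have := step _ _ xab tab xt; rewrite w0 sh0 !subr0 => /le_trans; apply.
  by rewrite ler_wpM2l// /sh /weight; have := expR_ge0 (- (k * (t - xi))); lra.
have := step _ _ tab xab tx; rewrite w0 sh0 !sub0r normrN => /le_trans; apply.
by rewrite ler_wpM2l// /sh /weight; have := expR_ge0 (k * (t - xi)); lra.
Qed.

End Comparison.

Section Gronwall.
Context {R : realType}.

(** Let S be the maximum of the ratio of the norm of u to the weight. The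
    hypothesis bounds the derivative by L S + c times the weight, and comparison
    bounds u by (L S + c) / (L + 1) times the weight. Evaluated where the maximum
    is attained, this gives S <= c. *)
Lemma gronwall p q (a b xi L c : R) (u du : R -> 'M[R]_(p, q)) :
  0 <= L -> 0 <= c -> xi \in `[a, b] -> {within `[a, b], continuous u} ->
  (forall t, t \in `]a, b[ -> is_derive t 1 u (du t)) ->
  (forall t i j, t \in `]a, b[ -> `|du t i j| <= L * `|u t| + c) -> u xi = 0 ->
  forall t, t \in `[a, b] -> `|u t| <= c * (2 * expR ((L + 1) * (b - a))).
Proof.
move=> L0 c0 xab uc ud duL u0; set k := L + 1.
have k0 : 0 < k by rewrite ltr_wpDl.
have W0 t : 0 < weight k xi t by apply: lt_le_trans (weight_ge1 _ _ _).
pose r t := `|u t| / weight k xi t.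
have rc : {within `[a, b], continuous r}.
  move=> s; apply: cvgM; first by apply: cvg_norm; exact: uc.
  apply: cvgV; first by rewrite gt_eqF.
  exact: (continuous_subspaceT (@weight_continuous R k xi)).
have ab : a <= b by move: xab; rewrite in_itv/= => /andP[/le_trans]; apply.
have [t0 t0ab rmax] := EVT_max ab rc.
have uS t : t \in `[a, b] -> `|u t| <= r t0 * weight k xi t.
  by move=> /rmax; rewrite {1}/r ler_pdivrMr.
have r0 : 0 <= r t0 by rewrite divr_ge0// ltW.
have A0 : 0 <= L * r t0 + c by rewrite addr_ge0// mulr_ge0.
have subab t : t \in `]a, b[ -> t \in `[a, b] by exact: subset_itv_oo_cc.
have uS' t : t \in `[a, b] -> `|u t| <= (L * r t0 + c) / k * weight k xi t.
  move=> tab; apply: mx_norm_le => [|i j].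
    by rewrite mulr_ge0// ?divr_ge0// ltW.
  have wc : {within `[a, b], continuous (fun s => u s i j)}.
    by move=> s; exact: cvg_entry (uc s).
  have wd s : s \in `]a, b[ -> is_derive s 1 (fun s => u s i j) (du s i j).
    by move=> /ud /is_derive_mxP.
  have dwA s : s \in `]a, b[ -> `|du s i j| <= (L * r t0 + c) * weight k xi s.
    move=> sab; apply: le_trans (duL s i j sab) _.
    rewrite mulrDl lerD//; first by rewrite -mulrA ler_wpM2l// uS// subab.
    by rewrite ler_peMr// weight_ge1.
  have w0 : u xi i j = 0 by rewrite u0 mxE.
  exact: comparison k0 A0 xab wc wd dwA w0 t tab.
have rle : r t0 <= c.
  have := uS' _ t0ab; rewrite -ler_pdivrMr// -/(r t0).
  by rewrite ler_pdivlMr// /k mulrDr mulr1 [r t0 * L]mulrC lerD2l.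
move=> t tab; apply: le_trans (uS t tab) _.
apply: ler_pM => //; first exact: ltW.
by apply: weight_le => //; exact: ltW.
Qed.

End Gronwall.

(** * Global existence for Lipschitz equations *)

Section Picard.
Context {R : realType}.

(** The limit is the supremum of v n - 2 C / 2 ^ n, which is nondecreasing and
    stays below the nonincreasing v n + 2 C / 2 ^ n. *)
Lemma geometric_limit (C : R) (v : nat -> R) :
  (forall n, `|v n.+1 - v n| <= C / 2 ^+ n) ->
  exists l, forall n, `|l - v n| <= 2 * C / 2 ^+ n.
Proof.
move=> vC.
have half n : 2 * C / 2 ^+ n.+1 = C / 2 ^+ n.
  by rewrite exprS invfM mulrACA divff ?mul1r// pnatr_eq0.
have two n : 2 * C / 2 ^+ n = C / 2 ^+ n + C / 2 ^+ n.
  by rewrite -mulrA mulr2n mulrDl !mul1r.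
have step n : v n - 2 * C / 2 ^+ n <= v n.+1 - 2 * C / 2 ^+ n.+1 /\
    v n.+1 + 2 * C / 2 ^+ n.+1 <= v n + 2 * C / 2 ^+ n.
  have := vC n; rewrite ler_norml half two => /andP[? ?]; split; lra.
have C0 n : 0 <= 2 * C / 2 ^+ n by rewrite two addr_ge0// (le_trans _ (vC n)).
have incr n m : v n - 2 * C / 2 ^+ n <= v (n + m)%N - 2 * C / 2 ^+ (n + m).
  elim: m => [|m IH]; first by rewrite addn0.
  by rewrite addnS; apply: le_trans IH (step _).1.
have decr n m : v (n + m)%N + 2 * C / 2 ^+ (n + m) <= v n + 2 * C / 2 ^+ n.
  elim: m => [|m IH]; first by rewrite addn0.
  by rewrite addnS; apply: le_trans (step _).2 IH.
have cross n m : v n - 2 * C / 2 ^+ n <= v m + 2 * C / 2 ^+ m.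
  have := incr n m; have := decr m n; have := C0 (n + m)%N.
  rewrite [(m + n)%N]addnC; lra.
pose S := range (fun n => v n - 2 * C / 2 ^+ n).
have S0 : S !=set0 by exists (v 0%N - 2 * C / 2 ^+ 0), 0%N.
exists (sup S) => n; rewrite ler_distl; apply/andP; split.
  apply: ub_le_sup; last by exists n.
  by exists (v n + 2 * C / 2 ^+ n) => _ [m _ <-].
by apply: ge_sup => // _ [m _ <-].
Qed.

Lemma geometric_small (K e : R) : 0 < e -> exists n, K / 2 ^+ n <= e.
Proof.
move=> e0; have := archi_boundP (normr_ge0 (K / e)); set n := Num.bound _ => Kn.
exists n; rewrite ler_pdivrMr ?exprn_gt0// mulrC -ler_pdivrMr//.
apply: le_trans (ler_norm _) (ltW (lt_le_trans Kn _)).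
by rewrite -natrX ler_nat ltnW// ltn_expl.
Qed.

(** Global existence by successive approximations. With k = 2 L + 1, one
    application of the integral operator T halves distances measured relative to
    the weight, on the whole line. The iterates thus converge geometrically and
    locally uniformly, and the limit is a continuous fixed point of T. *)
Lemma picard p q (L C xi : R) (g : R -> 'M[R]_(p, q) -> 'M[R]_(p, q))
    (eta : 'M[R]_(p, q)) : 0 <= L ->
  (forall u : R -> 'M[R]_(p, q), continuous u -> continuous (fun t => g t (u t))) ->
  (forall t u v i j, `|(g t u - g t v) i j| <= L * `|u - v|) ->
  (forall t i j, `|g t eta i j| <= C) ->
  exists u : R -> 'M[R]_(p, q),
    u xi = eta /\ forall t, is_derive t (1 : R) u (g t (u t)).
Proof.
move=> L0 gc gL gC.
have /choice[P HP] : forall h : R -> R, exists H : R -> R,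
    continuous h -> H xi = 0 /\ forall t : R, is_derive t 1 H (h t).
  move=> h; have [hc|nhc] := pselect (continuous h); last by exists h.
  by have [H ?] := primitive_exists xi hc; exists H.
(* P h is the primitive of h that vanishes at xi *)
pose T (u : R -> 'M[R]_(p, q)) t : 'M[R]_(p, q) :=
  \matrix_(i, j) (eta i j + P (fun s => g s (u s) i j) t).
have gij (u : R -> 'M[R]_(p, q)) i j : continuous u ->
  continuous (fun t => g t (u t) i j).
  by move=> /gc gu t; exact: cvg_entry (gu t).
have Txi u : continuous u -> T u xi = eta.
  by move=> uc; apply/matrixP => i j; rewrite mxE (HP _ (gij u i j uc)).1 addr0.
have Td u t : continuous u -> is_derive t (1 : R) (T u) (g t (u t)).
  move=> uc; apply/is_derive_mxP => i j.
  have := is_deriveD (is_derive_cst (eta i j) t (1 : R)) ((HP _ (gij u i j uc)).2 t).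
  by rewrite add0r; congr is_derive; apply/funext => s; rewrite mxE.
have Tc u : continuous u -> continuous (T u).
  by move=> uc t; exact: is_derive_cts (Td u t uc).
pose k := 2 * L + 1.
have k0 : 0 < k by rewrite ltr_wpDl// mulr_ge0.
have W1 t : 1 <= weight k xi t := weight_ge1 k xi t.
have W0 t : 0 <= weight k xi t by apply: le_trans (W1 t).
(* integration from xi gains a factor 1 / k *)
have compT (u v du dv : R -> 'M[R]_(p, q)) A t : 0 <= A ->
    (forall s, is_derive s (1 : R) u (du s)) ->
    (forall s, is_derive s (1 : R) v (dv s)) -> u xi = v xi ->
    (forall s i j, `|(du s - dv s) i j| <= A * weight k xi s) ->
    `|u t - v t| <= A / k * weight k xi t.
  move=> A0 ud vd uvxi duvA; apply: mx_norm_le => [|i j].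
    by rewrite mulr_ge0// divr_ge0// ltW.
  have wd s : is_derive s (1 : R) (fun s => (u s - v s) i j) ((du s - dv s) i j).
    by move: (is_deriveB (ud s) (vd s)) => /is_derive_mxP.
  pose a := Num.min xi t; pose b := Num.max xi t.
  have xab : xi \in `[a, b].
    by rewrite in_itv/= ge_min lexx le_max lexx.
  have tab : t \in `[a, b].
    by rewrite in_itv/= ge_min lexx le_max lexx !orbT.
  have wc : {within `[a, b], continuous (fun s => (u s - v s) i j)}.
    by apply: continuous_subspaceT => s; exact: is_derive_cts (wd s).
  have w0 : (u xi - v xi) i j = 0 by rewrite uvxi subrr mxE.
  exact: comparison k0 A0 xab wc (fun s _ => wd s) (fun s _ => duvA s i j) w0 t tab.
pose U n := iter n T (fun=> eta).
have Uc n : continuous (U n).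
  elim: n => [|n IH]; last exact: Tc.
  by move=> t; exact: cvg_cst.
have Uxi n : U n xi = eta by case: n => [//|n]; rewrite /U iterS Txi//; exact: Uc.
have k1 : 1 <= k by rewrite lerDr mulr_ge0.
have Lk A n : 0 <= A -> L * (A / 2 ^+ n) / k <= A / 2 ^+ n.+1.
  move=> A0; have -> : A / 2 ^+ n.+1 = A / 2 ^+ n / 2 by rewrite exprSr invfM mulrA.
  rewrite ler_pdivrMr//.
  set X := A / 2 ^+ n; have X0 : 0 <= X by rewrite mulr_ge0// invr_ge0 exprn_ge0.
  have -> : X / 2 * k = L * X + X / 2 by rewrite /k; field.
  by rewrite lerDl divr_ge0.
have Ustep n t : `|U n.+1 t - U n t| <= `|C| / 2 ^+ n * weight k xi t.
  elim: n t => [|n IH] t.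
    have dle s i j : `|(g s (U 0%N s) - 0) i j| <= `|C| * weight k xi s.
      rewrite subr0; apply: le_trans (gC s i j) _.
      by apply: le_trans (ler_norm C) _; rewrite ler_peMr.
    have U0d s : is_derive s (1 : R) (U 0%N) 0 by exact: is_derive_cst.
    have := compT _ _ _ _ _ t (normr_ge0 C) (fun s => Td _ s (Uc 0%N)) U0d
      (etrans (Uxi 1%N) (esym (Uxi 0%N))) dle.
    move=> /le_trans; apply; rewrite ler_wpM2r// expr0.
    by rewrite ler_wpM2l// lef_pV2 ?posrE.
  have dle s i j : `|(g s (U n.+1 s) - g s (U n s)) i j|
      <= L * (`|C| / 2 ^+ n) * weight k xi s.
    by apply: le_trans (gL _ _ _ _ _) _; rewrite -mulrA ler_wpM2l.
  have A0 : 0 <= L * (`|C| / 2 ^+ n).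
    by rewrite !mulr_ge0// invr_ge0 exprn_ge0.
  have := compT _ _ _ _ _ t A0 (fun s => Td _ s (Uc n.+1)) (fun s => Td _ s (Uc n))
    (etrans (Uxi n.+2) (esym (Uxi n.+1))) dle.
  by move=> /le_trans; apply; rewrite ler_wpM2r// Lk.
have /choice[u uP] : forall t, exists l : 'M[R]_(p, q),
    forall n, `|l - U n t| <= 2 * (`|C| * weight k xi t) / 2 ^+ n.
  move=> t.
  have /choice[l lP] : forall ij : 'I_p * 'I_q, exists l : R, forall n,
      `|l - U n t ij.1 ij.2| <= 2 * (`|C| * weight k xi t) / 2 ^+ n.
    move=> [i j]; apply: geometric_limit => n /=.
    have := mx_norm_entry (U n.+1 t - U n t) i j; rewrite !mxE => /le_trans; apply.
    by rewrite mulrAC.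
  exists (\matrix_(i, j) l (i, j)) => n; apply: mx_norm_le => [|i j].
    by rewrite !mulr_ge0// invr_ge0 exprn_ge0.
  by rewrite !mxE; exact: (lP (i, j)).
have uc : continuous u.
  move=> t; apply/cvgrPdist_le => e e0.
  have e3 : 0 < e / 3 by rewrite divr_gt0.
  have [n nle] := geometric_small (2 * (`|C| * (weight k xi t + 1))) e3.
  near=> s.
  have -> : u t - u s = (u t - U n t) + (U n t - U n s) - (u s - U n s).
    by rewrite opprB !subrKA.
  have -> : e = e / 3 + e / 3 + e / 3 by field.
  have small r : weight k xi r <= weight k xi t + 1 -> `|u r - U n r| <= e / 3.
    move=> rt; apply: le_trans (uP r n) _; apply: le_trans nle.
    by rewrite ler_wpM2r ?invr_ge0 ?exprn_ge0// !ler_wpM2l.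
  apply: le_trans (ler_normB _ _) _; apply: lerD.
    apply: le_trans (ler_normD _ _) _; apply: lerD; first by rewrite small// lerDl.
    by near: s; exact: (cvgrPdist_le _ _).1 (Uc n t) _ e3.
  apply: small; rewrite -lerBlDl.
  apply: le_trans (ler_norm _) _; rewrite distrC.
  by near: s; exact: (cvgrPdist_le _ _).1 (@weight_continuous R k xi t) _ ltr01.
have uT t : T u t = u t.
  apply/eqP; rewrite -subr_eq0 -normr_le0; apply/ler_addgt0Pl => e e0.
  rewrite addr0.
  have [n nle] := geometric_small (2 * (`|C| * weight k xi t)) e0.
  apply: le_trans nle.
  have dle s i j : `|(g s (u s) - g s (U n s)) i j|
      <= L * ((2 * `|C|) / 2 ^+ n) * weight k xi s.
    apply: le_trans (gL _ _ _ _ _) _; rewrite -mulrA ler_wpM2l//.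
    by apply: le_trans (uP s n) _; rewrite mulrA mulrAC.
  have A0 : 0 <= L * ((2 * `|C|) / 2 ^+ n).
    by rewrite !mulr_ge0// invr_ge0 exprn_ge0.
  have := compT _ _ _ _ _ t A0 (fun s => Td _ s uc) (fun s => Td _ s (Uc n))
    (etrans (Txi u uc) (esym (Uxi n.+1))) dle.
  rewrite -[T (U n)]/(U n.+1) => TuU.
  have -> : T u t - u t = (T u t - U n.+1 t) - (u t - U n.+1 t).
    by rewrite opprB subrKA.
  apply: le_trans (ler_normB _ _) _.
  have TuU2 : `|T u t - U n.+1 t| <= 2 * `|C| / 2 ^+ n.+1 * weight k xi t.
    by apply: le_trans TuU _; rewrite ler_wpM2r// Lk// mulr_ge0.
  apply: le_trans (lerD TuU2 (uP t n.+1)) _.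
  rewrite le_eqVlt; apply/orP; left; apply/eqP.
  by rewrite exprS; field.
exists u; split; first by rewrite -uT Txi.
move=> t; rewrite -{1}(_ : T u = u); first exact: Td.
exact/funext.
Unshelve. all: by end_near.
Qed.

End Picard.

(** * Mean value estimates for continuously differentiable vector fields *)

Section UniformContinuity.
Context {R : realType} {U W : normedModType R}.

(** Compactness of the segment makes continuity of F uniform near the arc traced
    by g, although no neighbourhood of the arc need be compact. *)
Lemma unif_continuous_along (F : U -> W) (g : R -> U) (a b e : R) :
  continuous F -> continuous g -> 0 < e ->
  exists2 rho : R, 0 < rho & forall t d, t \in `[a, b] -> `|d| <= rho ->
    `|F (g t + d) - F (g t)| <= e.
Proof.
move=> Fc gc e0.
have e2 : 0 < e / 2 by rewrite divr_gt0.
have /compact_near_coveringP/(_ U (nbhs (0 : U))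
    (fun d t => `|F (g t + d) - F (g t)| <= e)) := @segment_compact R a b.
move=> /(_ _) cov.
have : \forall d \near (0 : U), `[a, b] `<=` (fun t => `|F (g t + d) - F (g t)| <= e).
  apply: cov => x xab.
  have g1 : g td.1 @[td --> filter_prod (nbhs x) (nbhs (0 : U))] --> g x.
    exact: cvg_comp (@cvg_fst _ _ (nbhs x) (nbhs (0 : U)) _) (gc x).
  have g12 : g td.1 + td.2 @[td --> filter_prod (nbhs x) (nbhs (0 : U))] --> g x.
    rewrite -[X in _ --> X]addr0; apply: cvgD g1 _.
    exact: (@cvg_snd _ _ (nbhs x) (nbhs (0 : U))).
  have c1 := cvg_comp _ _ g12 (Fc (g x)).
  have c2 := cvg_comp _ _ g1 (Fc (g x)).
  move/cvgrPdist_le : c1 => /(_ _ e2) c1; move/cvgrPdist_le : c2 => /(_ _ e2) c2.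
  near=> td.
  rewrite -(subrKA (F (g x))) (splitr e) (le_trans (ler_normD _ _))// lerD//.
    by rewrite distrC; near: td; exact: c1.
  by near: td; exact: c2.
move=> /nbhs_norm0P[r /= r0 rP]; exists (r / 2); first by rewrite divr_gt0.
move=> t d tab dr; apply: rP => //=.
by rewrite (le_lt_trans dr)// gtr_pMr// invf_lt1// ltr1n.
Unshelve. all: by end_near. Qed.

End UniformContinuity.

Section Box.
Context {R : realType} {m : nat}.
Notation V := 'cV[R]_m.

Definition box (M : R) : set V := [set v | `|v| <= M].

(** Heine-Borel for column vectors, by transposing a product of segments. *)
Lemma box_compact (M : R) : compact (box M).
Proof.
have [M0|M0] := leP 0 M; last first.
  rewrite (_ : box M = set0); first exact: compact0.
  by rewrite -subset0 => v /= /(le_trans (normr_ge0 v)); rewrite leNgt M0.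
have -> : box M =
    (fun v : 'rV[R]_m => v^T) @` [set v : 'rV[R]_m | forall i, v ord0 i \in `[- M, M]].
  apply/seteqP; split=> [v vM|_ [v vM <-]].
    exists v^T; last by rewrite trmxK.
    by move=> i; rewrite mxE in_itv/= -ler_norml (le_trans (mx_norm_entry _ _ _)).
  apply: mx_norm_le => // i j; rewrite mxE ord1 ler_norml.
  by have := vM i; rewrite in_itv/=.
apply: continuous_compact.
  apply: continuous_subspaceT => v; apply: (@cvg_mx _ _ (nbhs v)) => i j; rewrite mxE.
  under eq_fun do rewrite mxE.
  exact: coord_continuous.
apply: (@rV_compact _ _ (fun=> `[- M, M]%classic)) => _; exact: segment_compact.
Qed.

Lemma continuous_bounded_box (F : V * V -> 'M[R]_m) (M : R) : continuous F ->
  exists2 N : R, 0 <= N & forall p, box M p.1 -> box M p.2 -> `|F p| <= N.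
Proof.
move=> Fc.
have /compact_bounded[N [_ NP]] :
    compact (F @` (box M `*` box M)).
  apply: continuous_compact; first exact: continuous_subspaceT.
  exact: compact_setX (@box_compact M) (@box_compact M).
exists (`|N| + 1) => [|p p1 p2]; first by rewrite addr_ge0.
by apply: NP; [rewrite ltr_pwDr// ler_norm|exists p].
Qed.

Lemma box_convex (M : R) (z h : V) (c : R) : c \in `[0, 1] ->
  box M z -> box M (z + h) -> box M (z + c *: h).
Proof.
rewrite in_itv/= /box/= => /andP[c0 c1] zM hM.
have -> : z + c *: h = (1 - c) *: z + c *: (z + h).
  by rewrite scalerBl scalerDr scale1r addrA subrK.
have -> : M = (1 - c) * M + c * M by rewrite -mulrDl subrK mul1r.
rewrite (le_trans (ler_normD _ _))// !normrZ [`|c|]ger0_norm// ger0_norm ?subr_ge0//.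
by rewrite lerD// ler_wpM2l// subr_ge0.
Qed.

End Box.

Lemma entry_mulmx_sub {R : realType} {m : nat} (A A' B B' : 'M[R]_m)
    (h k : 'cV[R]_m) i :
  (A *m h + B *m k) i 0 - (A' *m h + B' *m k) i 0 =
  ((A - A') *m h) i 0 + ((B - B') *m k) i 0.
Proof.
rewrite !mulmxBl; move: (A *m h) (A' *m h) (B *m k) (B' *m k) => a a' b b'.
by rewrite !mxE; ring.
Qed.

Section MeanValue.
Context {R : realType} {m : nat}.
Notation V := 'cV[R]_m.
Variable f : V -> V -> V.
Hypothesis hf : C1 f.

Let F (p : V * V) := f p.1 p.2.

Lemma is_derive_line (U W : normedModType R) (g : U -> W) (p d : U) (s : R) :
  differentiable g (p + s *: d) ->
  is_derive s (1 : R) (fun r => g (p + r *: d)) ('d g (p + s *: d) d).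
Proof.
move=> dg; have : derivable g (p + s *: d) d by exact: diff_derivable.
rewrite -deriveE//.
have E : (fun h : R => h^-1 *: ((g \o shift (p + s *: d)) (h *: d) - g (p + s *: d)))
  = (fun h : R => h^-1 *: (((fun r => g (p + r *: d)) \o shift s) (h *: 1) -
     (fun r => g (p + r *: d)) s)).
  apply/funext => h /=; congr (_ *: (g _ - _)).
  by rewrite [h *: 1]mulr1 scalerDl addrCA.
rewrite /derivable E => dg'; apply: DeriveDef => //.
by rewrite /derive E.
Qed.

Lemma derive_partial1 (z w v : V) : 'D_v (fun z' => f z' w) z = 'd F (z, w) (v, 0).
Proof.
have [dF _ _] := hf.
have E : (fun r : R => r^-1 *: (((fun z' => f z' w) \o shift z) (r *: v) - f z w))
    = (fun r : R => r^-1 *: ((F \o shift (z, w)) (r *: (v, 0 : V)) - F (z, w))).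
  by apply/funext => r; rewrite /F /= scaler0 add0r.
by rewrite -(deriveE (v, 0) (dF (z, w))) /derive E.
Qed.

Lemma derive_partial2 (z w v : V) : 'D_v (f z) w = 'd F (z, w) (0, v).
Proof.
have [dF _ _] := hf.
have E : (fun r : R => r^-1 *: ((f z \o shift w) (r *: v) - f z w))
    = (fun r : R => r^-1 *: ((F \o shift (z, w)) (r *: (0 : V, v)) - F (z, w))).
  by apply/funext => r; rewrite /F /= scaler0 add0r.
by rewrite -(deriveE (0, v) (dF (z, w))) /derive E.
Qed.

(** The matrices F1 and F2 are made of partial derivatives; differentiability in
    both variables jointly makes them the two blocks of the differential. *)
Lemma jac_diff (p : V * V) (h k : V) :
  'd F p (h, k) = F1 f p.1 p.2 *m h + F2 f p.1 p.2 *m k.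
Proof.
have delta_sum (v : V) : v = \sum_j v j 0 *: delta_mx j 0.
  by rewrite {1}[v]matrix_sum_delta; apply: eq_bigr => j _; rewrite big_ord1.
have hE : (h, 0) = \sum_j h j 0 *: (delta_mx j 0, 0) :> V * V.
  rewrite {1}[h]delta_sum.
  by elim/big_rec2: _ => // j a b _ <-; congr pair; rewrite /= ?scaler0 ?add0r.
have kE : (0, k) = \sum_j k j 0 *: (0, delta_mx j 0) :> V * V.
  rewrite {1}[k]delta_sum.
  by elim/big_rec2: _ => // j a b _ <-; congr pair; rewrite /= ?scaler0 ?add0r.
have -> : (h, k) = (h, 0) + (0, k) :> V * V by congr pair; rewrite /= ?addr0 ?add0r.
rewrite linearD hE kE !linear_sum; congr +%R.
- apply/matrixP => i j; rewrite ord1 summxE mxE.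
  apply: eq_bigr => l _; rewrite linearZ mxE mulrC; congr (_ * _).
  by rewrite /F1 mxE derive_partial1 -surjective_pairing.
- apply/matrixP => i j; rewrite ord1 summxE mxE.
  apply: eq_bigr => l _; rewrite linearZ mxE mulrC; congr (_ * _).
  by rewrite /F2 mxE derive_partial2 -surjective_pairing.
Qed.

(** The intermediate point depends on the entry i, hence the statement by
    entries. *)
Lemma mean_value (z w h k : V) i : exists2 c : R, c \in `[0, 1] &
  (f (z + h) (w + k) - f z w) i 0 =
  (F1 f (z + c *: h) (w + c *: k) *m h + F2 f (z + c *: h) (w + c *: k) *m k) i 0.
Proof.
have [dF _ _] := hf.
pose g r := F ((z, w) + r *: (h, k)) i 0.
have gd r : is_derive r (1 : R) g ('d F ((z, w) + r *: (h, k)) (h, k) i 0).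
  by have /is_derive_mxP/(_ i 0) := @is_derive_line _ _ F (z, w) (h, k) r (dF _).
have gc : {within `[0, 1], continuous g}.
  by apply: continuous_subspaceT => r; exact: is_derive_cts (gd r).
have [c c01 gE] := MVT_segment ler01 (fun r _ => gd r) gc.
exists c => //; move: gE; rewrite jac_diff subr0 mulr1 => <-.
by rewrite /g /F/= scale1r scale0r !addr0 !scale1r !scale0r !addr0 !mxE.
Qed.

Lemma lipschitz_box (M : R) : exists2 L : R, 0 <= L &
  forall z z' w w' i, box M z -> box M z' -> box M w -> box M w' ->
    `|(f z w - f z' w') i 0| <= L * (`|z - z'| + `|w - w'|).
Proof.
have [_ c1 c2] := hf.
have [N1 N10 N1P] := continuous_bounded_box M c1.
have [N2 N20 N2P] := continuous_bounded_box M c2.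
have mN1 : 0 <= m%:R * N1 by rewrite mulr_ge0.
have mN2 : 0 <= m%:R * N2 by rewrite mulr_ge0.
exists (m%:R * N1 + m%:R * N2) => [|z z' w w' i zM zM' wM wM'].
  exact: addr_ge0.
have [c c01] := mean_value z' w' (z - z') (w - w') i.
rewrite ![_ + (_ - _)]addrC !subrK => ->.
have b1 : box M (z' + c *: (z - z')) by apply: box_convex; rewrite // addrC subrK.
have b2 : box M (w' + c *: (w - w')) by apply: box_convex; rewrite // addrC subrK.
rewrite mxE (le_trans (ler_normD _ _))// mulrDr; apply: lerD.
  apply: le_trans (mulmx_entry_le _ _ _ N10 _) _; last by rewrite ler_wpM2r// lerDl.
  by move=> i' j'; apply: le_trans (mx_norm_entry _ _ _) (N1P (_, _) _ _).
apply: le_trans (mulmx_entry_le _ _ _ N20 _) _; last by rewrite ler_wpM2r// lerDr.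
by move=> i' j'; apply: le_trans (mx_norm_entry _ _ _) (N2P (_, _) _ _).
Qed.

(** The first-order expansion of f along the curve (y, psi), with a remainder that
    is small uniformly in time. *)
Lemma uniform_linearization (y psi : R -> V) (a b e : R) :
  continuous y -> continuous psi -> 0 < e ->
  exists2 rho : R, 0 < rho & forall t h k i, t \in `[a, b] ->
    `|h| <= rho -> `|k| <= rho ->
    `|(f (y t + h) (psi t + k) - f (y t) (psi t)
        - (F1 f (y t) (psi t) *m h + F2 f (y t) (psi t) *m k)) i 0|
      <= e * (`|h| + `|k|).
Proof.
move=> yc psic e0; have [_ c1 c2] := hf.
(* products with m-column matrices of entries below e' cost a factor m *)
pose e' := e / m.+1%:R.
have e'0 : 0 < e' by rewrite divr_gt0.
have me' : m%:R * e' <= e.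
  by rewrite /e' mulrCA ger_pMr// ler_pdivrMr// mul1r ler_nat.
have gc : continuous (fun t => (y t, psi t)).
  by move=> t; exact: cvg_pair (yc t) (psic t).
have [r1 r10 r1P] := unif_continuous_along a b c1 gc e'0.
have [r2 r20 r2P] := unif_continuous_along a b c2 gc e'0.
exists (Num.min r1 r2) => [|t h k i tab]; first by rewrite lt_min r10.
rewrite !le_min => /andP[h1 h2] /andP[k1 k2].
have [c c01 E] := mean_value (y t) (psi t) h k i.
have c0 : 0 <= c <= 1 by move: c01; rewrite in_itv.
have ch (v : V) r : `|v| <= r -> `|c *: v| <= r.
  move=> vr; rewrite normrZ ger0_norm; last by case/andP: c0.
  by apply: le_trans vr; rewrite ler_piMl//; case/andP: c0.
have d1 r : `|h| <= r -> `|k| <= r -> `|(c *: h, c *: k)| <= r.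
  by move=> hr kr; rewrite prod_normE/= ge_max !ch.
rewrite mxE [X in _ + X]mxE E entry_mulmx_sub.
rewrite (le_trans (ler_normD _ _))// mulrDr; apply: lerD.
  apply: le_trans (mulmx_entry_le _ _ _ (ltW e'0) _) _; last by rewrite ler_wpM2r.
  move=> i' j'; apply: le_trans (mx_norm_entry _ _ _) _.
  exact: (r1P t (c *: h, c *: k) tab (d1 _ h1 k1)).
apply: le_trans (mulmx_entry_le _ _ _ (ltW e'0) _) _; last by rewrite ler_wpM2r.
move=> i' j'; apply: le_trans (mx_norm_entry _ _ _) _.
exact: (r2P t (c *: h, c *: k) tab (d1 _ h2 k2)).
Qed.

End MeanValue.

(** * Derivatives relative to a segment *)

Lemma near_within_dnbhsE {T : topologicalType} (D : set T) (t : T) (P : T -> Prop) :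
  (\forall s \near within D t^', P s) = \forall s \near t, s != t -> D s -> P s.
Proof. by []. Qed.

Lemma near_dnbhsE {T : topologicalType} (t : T) (P : T -> Prop) :
  (\forall s \near t^', P s) = \forall s \near t, s != t -> P s.
Proof. by []. Qed.

Section Within.
Context {R : realType} {V : normedModType R}.
Implicit Types (D : set R) (u : R -> V) (t : R).

Lemma is_derive_within_continuous D u t l :
  is_derive_within D u t l -> u @ within D (nbhs t) --> u t.
Proof.
move=> ul.
have st : (s - t) @[s --> within D t^'] --> (0 : R).
  have : (s - t) @[s --> t] --> t - t by apply: cvgB; [exact: cvg_id|exact: cvg_cst].
  rewrite subrr; apply: cvg_trans; apply: cvg_app.
  by apply: cvg_trans (cvg_within _) _; exact: cvg_within.
have FF : Filter (within D t^') by apply: within_filter.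
have := @cvgZ _ _ _ _ FF _ _ _ _ st ul; rewrite scale0r => /cvgrPdist_le qP.
apply/cvgrPdist_le => e e0; have := qP e e0.
rewrite near_within_dnbhsE near_withinE; apply: filterS => s sP Ds.
have [->|st'] := eqVneq s t; first by rewrite subrr normr0 ltW.
have := sP st' Ds; rewrite sub0r normrN scalerA divff ?subr_eq0// scale1r.
by rewrite distrC.
Qed.

Lemma is_derive_within_itv (a b : R) u t l : t \in `]a, b[ ->
  is_derive_within `[a, b] u t l -> is_derive t (1 : R) u l.
Proof.
move=> tab ul.
have nab : \forall s \near t, `[a, b]%classic s.
  have := near_in_itvoo tab; apply: filterS => s; exact: subset_itv_oo_cc.
have ul' : (fun h : R => h^-1 *: (u (h *: 1 + t) - u t)) @ 0^' --> l.
  apply/cvgrPdist_le => e e0; move/cvgrPdist_le : ul => /(_ e e0).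
  rewrite near_within_dnbhsE near_dnbhsE => ul.
  have : \forall s \near t, s != t -> `|l - (s - t)^-1 *: (u s - u t)| <= e.
    by apply: filterS2 nab ul => s sab sP st; exact: sP.
  rewrite (near_shift 0 t) subr0; apply: filterS => h hP h0.
  have := hP; rewrite /= addrK -subr_eq0 addrK => /(_ h0).
  by rewrite [h *: 1]mulr1.
apply: DeriveDef; first by apply/cvg_ex; exists l.
exact/cvg_lim.
Qed.

Lemma is_derive_is_within D u t l : is_derive t (1 : R) u l ->
  is_derive_within D u t l.
Proof.
move=> [du <-]; apply/cvgrPdist_le => e e0.
move/cvgrPdist_le: du => /(_ e e0).
rewrite near_within_dnbhsE near_dnbhsE (near_shift t 0) sub0r.
apply: filterS => s sP st Ds.
have := sP; rewrite /= subr_eq0 => /(_ st).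
by rewrite [(s - t) *: 1]mulr1 subrK.
Qed.

Lemma eq_is_derive_within D u v t l : D t -> {in D, u =1 v} ->
  is_derive_within D u t l -> is_derive_within D v t l.
Proof.
move=> Dt uv /cvgrPdist_le ul; apply/cvgrPdist_le => e e0; have := ul e e0.
rewrite !near_within_dnbhsE; apply: filterS => s sP st Ds.
by rewrite -!uv ?inE//; exact: sP.
Qed.

End Within.

(** * Existence, uniqueness and first-order dependence of perturbed solutions *)

Section Clip.
Context {R : realType} {m : nat}.
Notation V := 'cV[R]_m.

(** Entrywise truncation, a 1-Lipschitz retraction onto the box for the max norm.
    Composing f with it produces a globally Lipschitz vector field, to which
    global existence applies. *)
Definition clip (M : R) (v : V) : V := \col_i clamp (- M) M (v i 0).

Lemma clip_box M v : 0 <= M -> box M (clip M v).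
Proof.
move=> M0; apply: mx_norm_le => // i j; rewrite mxE ler_norml.
have := @clamp_in R (- M) M (v i 0); rewrite in_itv/=; apply.
by rewrite ge0_cp.
Qed.

Lemma clip_id M v : box M v -> clip M v = v.
Proof.
move=> vM; apply/matrixP => i j; rewrite mxE ord1 clamp_id//.
by rewrite in_itv/= -ler_norml (le_trans (mx_norm_entry _ _ _)).
Qed.

Lemma clip_dist M u v : `|clip M u - clip M v| <= `|u - v|.
Proof.
apply: mx_norm_le => // i j; rewrite !mxE (le_trans (clamp_dist _ _ _ _))//.
by have := mx_norm_entry (u - v) i 0; rewrite !mxE.
Qed.

Lemma clip_continuous M : continuous (clip M).
Proof.
move=> v; apply/(@cvgrPdist_le _ _ _ (nbhs v)) => e e0.
have /cvgrPdist_le/(_ e e0) : (id : V -> V) s @[s --> v] --> v by exact: cvg_id.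
by apply: filterS => s; exact: le_trans (clip_dist _ _ _).
Qed.

End Clip.

Lemma within_itv_bounded (R : realType) (V : normedModType R) (a b : R)
    (u : R -> V) : {within `[a, b], continuous u} ->
  exists2 M : R, 0 <= M & forall t, t \in `[a, b] -> `|u t| <= M.
Proof.
move=> uc.
have /compact_bounded[N [_ NP]] : compact (u @` `[a, b]).
  by apply: continuous_compact => //; exact: segment_compact.
exists (`|N| + 1) => [|t tab]; first by rewrite addr_ge0.
by apply: NP; [rewrite ltr_pwDr// ler_norm|exists t].
Qed.

Section Solutions.
Context {R : realType} {m : nat}.
Notation V := 'cV[R]_m.
Variable f : V -> V -> V.
Hypothesis hf : C1 f.
Variables a b xi : R.
Hypothesis xab : xi \in `[a, b].

(** The equation with prescribed delayed input psi, that is, an ordinary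
    differential equation; derivatives at the endpoints carry no information once
    continuity is known. *)
Definition solves (psi u : R -> V) : Prop :=
  {within `[a, b], continuous u} /\
  forall t, t \in `]a, b[ -> is_derive t (1 : R) u (f (u t) (psi t)).

Let subab t : t \in `]a, b[ -> t \in `[a, b].
Proof. exact: subset_itv_oo_cc. Qed.

Lemma solution_unique (psi u v : R -> V) :
  {within `[a, b], continuous psi} -> solves psi u -> solves psi v -> u xi = v xi ->
  forall t, t \in `[a, b] -> u t = v t.
Proof.
move=> psic [uc ud] [vc vd] uvxi t tab.
have [M1 M10 uM] := within_itv_bounded uc.
have [M2 M20 vM] := within_itv_bounded vc.
have [M3 M30 psiM] := within_itv_bounded psic.
pose M := M1 + M2 + M3.
have M1M : M1 <= M by rewrite /M -addrA lerDl addr_ge0.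
have M2M : M2 <= M by rewrite /M; lra.
have M3M : M3 <= M by rewrite /M lerDr addr_ge0.
have [L L0 LP] := lipschitz_box hf M.
have wc : {within `[a, b], continuous (fun s => u s - v s)}.
  by move=> s; exact: cvgB (uc s) (vc s).
have wd s : s \in `]a, b[ -> is_derive s (1 : R) (fun s => u s - v s)
    (f (u s) (psi s) - f (v s) (psi s)).
  by move=> sab; exact: is_deriveB (ud s sab) (vd s sab).
have dle s i j : s \in `]a, b[ ->
    `|(f (u s) (psi s) - f (v s) (psi s)) i j| <= L * `|u s - v s| + 0.
  move=> /subab sab; rewrite ord1.
  have := LP (u s) (v s) (psi s) (psi s) i.
  rewrite subrr normr0 !addr0; apply.
  - exact: le_trans (uM s sab) M1M.
  - exact: le_trans (vM s sab) M2M.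
  - exact: le_trans (psiM s sab) M3M.
  - exact: le_trans (psiM s sab) M3M.
have w0 : u xi - v xi = 0 by rewrite uvxi subrr.
have := gronwall L0 (lexx 0) xab wc wd dle w0 tab.
by rewrite mul0r normr_le0 subr_eq0 => /eqP.
Qed.

(** Let M be 1 plus the sum of the bounds on y and psi, and truncate the vector
    field outside the box of radius M. The truncated perturbed equation has a
    global solution, and it stays within C |e| of y on [a, b]. For small e this is
    at most 1, so the solution does not leave the box there and solves the original
    equation. *)
Lemma perturbed_solution (psi dpsi y : R -> V) (K D : R) :
  continuous psi -> continuous dpsi ->
  (forall t, `|psi t| <= K) -> (forall t, `|dpsi t| <= D) -> solves psi y ->
  exists C : R, 0 <= C /\ exists delta : R, 0 < delta /\
  forall e : R, `|e| <= delta -> exists z : R -> V,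
    [/\ z xi = y xi,
      forall t, t \in `[a, b] ->
        is_derive t (1 : R) z (f (z t) (psi t + e *: dpsi t)) &
      forall t, t \in `[a, b] -> `|z t - y t| <= C * `|e|].
Proof.
move=> psic dpsic psiK dpsiD [yc yd].
have [My My0 yM] := within_itv_bounded yc.
have K0 : 0 <= K := le_trans (normr_ge0 _) (psiK 0).
have D0 : 0 <= D := le_trans (normr_ge0 _) (dpsiD 0).
pose M := My + K + 1.
have M0 : 0 <= M by rewrite !addr_ge0.
have [L L0 LP] := lipschitz_box hf M.
pose E := 2 * expR ((L + 1) * (b - a)).
have E0 : 0 <= E by rewrite mulr_ge0// expR_ge0.
pose C := L * D * E.
have C0 : 0 <= C by rewrite !mulr_ge0.
exists C; split => //; exists (Num.min (D + 1)^-1 (C + 1)^-1); split.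
  by rewrite lt_min !invr_gt0 !ltr_wpDl.
move=> e; rewrite le_min => /andP[eD eC].
have eD1 : `|e| * D <= 1.
  apply: le_trans (_ : (D + 1)^-1 * D <= 1); first by rewrite ler_wpM2r.
  by rewrite mulrC ler_pdivrMr ?mul1r ?lerDl// ltr_wpDl.
have eC1 : C * `|e| <= 1.
  apply: le_trans (_ : C * (C + 1)^-1 <= 1); first by rewrite ler_wpM2l.
  by rewrite ler_pdivrMr ?mul1r ?lerDl// ltr_wpDl.
pose psie t := psi t + e *: dpsi t.
have psiec : continuous psie.
  by move=> t; apply: cvgD (psic t) _; apply: cvgZr; exact: dpsic.
have box0 : box M (0 : V) by rewrite /box/= normr0.
have psieM t : box M (psie t).
  rewrite /box/= (le_trans (ler_normD _ _))// normrZ.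
  have : `|e| * `|dpsi t| <= 1.
    by apply: le_trans eD1; rewrite ler_wpM2l.
  by have := psiK t; rewrite /M; lra.
have psiM t : box M (psi t).
  by rewrite /box/= (le_trans (psiK t))// /M; lra.
pose g t v := f (clip M v) (psie t).
have gc (u : R -> V) : continuous u -> continuous (fun t => g t (u t)).
  move=> uc t; have [dF _ _] := hf.
  have c1 : clip M (u s) @[s --> t] --> clip M (u t).
    exact: (cvg_comp _ _ (uc t) (@clip_continuous R m M (u t))).
  have Fc := differentiable_continuous (dF (clip M (u t), psie t)).
  exact: (cvg_comp _ _ (cvg_pair c1 (psiec t)) Fc).
have gL t u v i j : `|(g t u - g t v) i j| <= L * `|u - v|.
  rewrite ord1; have := LP (clip M u) (clip M v) (psie t) (psie t) i.
  rewrite subrr normr0 addr0 => /(_ _ _ _ _)/le_trans; apply => //.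
  - exact: clip_box.
  - exact: clip_box.
  - by rewrite ler_wpM2l// clip_dist.
have gC t i j : `|g t (y xi) i j| <= L * (M + M) + `|f 0 0|.
  rewrite ord1 -[g _ _](subrK (f 0 0)) mxE (le_trans (ler_normD _ _))//.
  apply: lerD; last exact: mx_norm_entry.
  have := LP (clip M (y xi)) 0 (psie t) 0 i (clip_box _ M0) box0 (psieM t) box0.
  move=> /le_trans; apply; rewrite !subr0 ler_wpM2l// lerD//.
    exact: clip_box.
  exact: psieM.
have [z [zxi zd]] := picard xi L0 gc gL gC.
have wc : {within `[a, b], continuous (fun s => z s - y s)}.
  move=> s; apply: cvgB (yc s).
  by apply: (continuous_subspaceT _ (x := s)) => r; exact: is_derive_cts (zd r).
have wd s : s \in `]a, b[ -> is_derive s (1 : R) (fun s => z s - y s)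
    (g s (z s) - f (y s) (psi s)).
  by move=> sab; exact: is_deriveB (zd s) (yd s sab).
have yM' s : s \in `[a, b] -> box M (y s).
  by move=> /yM ys; rewrite /box/= (le_trans ys)// /M; lra.
have LeD0 : 0 <= L * (`|e| * D) by rewrite !mulr_ge0.
have dle s i j : s \in `]a, b[ ->
    `|(g s (z s) - f (y s) (psi s)) i j| <= L * `|z s - y s| + L * (`|e| * D).
  move=> /subab sab; rewrite ord1 -mulrDr.
  have := LP (clip M (z s)) (y s) (psie s) (psi s) i (clip_box _ M0)
    (yM' s sab) (psieM s) (psiM s).
  move=> /le_trans; apply; rewrite ler_wpM2l// lerD//.
    by rewrite -{1}(clip_id (yM' s sab)) clip_dist.
  by rewrite /psie addrAC subrr add0r normrZ ler_wpM2l.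
have w0 : z xi - y xi = 0 by rewrite zxi subrr.
have zy t : t \in `[a, b] -> `|z t - y t| <= C * `|e|.
  move=> tab; have := gronwall L0 LeD0 xab wc wd dle w0 tab.
  move=> /le_trans; apply; rewrite le_eqVlt; apply/orP; left; apply/eqP.
  by rewrite /C /E; ring.
exists z; split => // t tab.
have zM : box M (z t).
  rewrite /box/= -(subrK (y t) (z t)) (le_trans (ler_normD _ _))//.
  have := le_trans (zy t tab) eC1; have := yM t tab; rewrite /M; lra.
by have := zd t; rewrite /g clip_id.
Qed.

End Solutions.

(** * Derivative of the solution with respect to the input *)

Section FundamentalMatrix.
Context {R : realType} {m : nat}.

(** The inverse of the fundamental matrix X is obtained as the solution Y of the
    adjoint equation: the derivative of Y X is zero. The propagator from s to t is
    then X t *m Y s. *)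
Lemma fundamental_matrix (A : R -> 'M[R]_m) (xi N : R) : continuous A ->
  0 <= N -> (forall t i j, `|A t i j| <= N) ->
  exists X Y : R -> 'M[R]_m,
    [/\ X xi = 1%:M, forall t, is_derive t (1 : R) X (A t *m X t),
        forall t, is_derive t (1 : R) Y (- (Y t *m A t)) &
        forall t, X t *m Y t = 1%:M].
Proof.
move=> Ac N0 AN.
have L0 : 0 <= m%:R * N by rewrite mulr_ge0.
have [X [Xxi Xd]] : exists X : R -> 'M[R]_m, X xi = 1%:M /\
    forall t, is_derive t (1 : R) X (A t *m X t).
  apply: (@picard R m m (m%:R * N) (m%:R * N * `|1%:M : 'M[R]_m|) xi
    (fun t M => A t *m M)) => //.
  - by move=> u uc t; exact: cvg_mulmx (Ac t) (uc t).
  - by move=> t u v i j; rewrite -mulmxBr mulmx_entry_le.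
  - by move=> t i j; rewrite mulmx_entry_le.
have [Y [Yxi Yd]] : exists Y : R -> 'M[R]_m, Y xi = 1%:M /\
    forall t, is_derive t (1 : R) Y (- (Y t *m A t)).
  apply: (@picard R m m (m%:R * N) (m%:R * N * `|1%:M : 'M[R]_m|) xi
    (fun t M => - (M *m A t))) => //.
  - by move=> u uc t; apply: cvgN; exact: cvg_mulmx (uc t) (Ac t).
  - by move=> t u v i j; rewrite -opprD -mulNmx -mulmxDl mxE normrN mulmx_entry_ler.
  - by move=> t i j; rewrite mxE normrN mulmx_entry_ler.
exists X, Y; split => // t; apply: mulmx1C.
have YXd s : is_derive s (1 : R) (fun s => Y s *m X s) 0.
  apply: is_derive_eq; first exact: is_derive_mulmx (Yd s) (Xd s).
  by rewrite mulNmx mulmxA addNr.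
have <- : Y xi *m X xi = 1%:M by rewrite Yxi Xxi mulmx1.
apply/matrixP => i j.
apply: (@is_derive_0_is_cst R (fun s => (Y s *m X s) i j)) => s.
by have /is_derive_mxP/(_ i j) := YXd s; rewrite [X in is_derive _ _ _ X]mxE.
Qed.

End FundamentalMatrix.

Lemma difference_quotient_linearization {R : realType} {m : nat}
    (A B : 'M[R]_m) (h delta d fd : 'cV[R]_m) (e : R) : e != 0 ->
  e^-1 *: fd - (A *m delta + B *m d) =
  A *m (e^-1 *: h - delta) + e^-1 *: (fd - (A *m h + B *m (e *: d))).
Proof.
move=> e0; rewrite mulmxBr -!scalemxAr scalerBr scalerDr scalerA mulVf// scale1r.
move: (A *m delta) (A *m h) (B *m d) => u v w.
by apply/matrixP => i j; rewrite !mxE; ring.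
Qed.

Section Variation.
Context {R : realType} {m : nat}.
Notation V := 'cV[R]_m.
Variable f : V -> V -> V.
Hypothesis hf : C1 f.
Variables a b xi : R.
Hypothesis xab : xi \in `[a, b].

(** Differentiability of the solution in the delayed input. The difference between
    the difference quotient and the solution delta of the variational equation
    satisfies the homogeneous linear equation up to a remainder that is o(1)
    uniformly in time, since perturbed solutions are within O(e) of y; then the
    Gronwall estimate applies. *)
Lemma solution_derivative (psi dpsi y delta : R -> V) (K D N : R)
    (Y : R -> R -> V) :
  continuous psi -> continuous dpsi -> continuous y ->
  (forall t, `|psi t| <= K) -> (forall t, `|dpsi t| <= D) -> 0 <= N ->
  (forall t i j, `|F1 f (y t) (psi t) i j| <= N) ->
  solves f a b psi y ->
  {within `[a, b], continuous delta} -> delta xi = 0 ->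
  (forall t, t \in `]a, b[ -> is_derive t (1 : R) delta
     (F1 f (y t) (psi t) *m delta t + F2 f (y t) (psi t) *m dpsi t)) ->
  (\forall e \near (0 : R)^',
     solves f a b (fun t => psi t + e *: dpsi t) (Y e) /\ Y e xi = y xi) ->
  forall t, t \in `[a, b] -> e^-1 *: (Y e t - y t) @[e --> (0 : R)^'] --> delta t.
Proof.
move=> psic dpsic ycT psiK dpsiD N0 F1N ysol deltac delta0 deltad Ysol t tab.
have [yc yd] := ysol.
have K0 : 0 <= K := le_trans (normr_ge0 _) (psiK 0).
have D0 : 0 <= D := le_trans (normr_ge0 _) (dpsiD 0).
have [C [C0 [d [d0 dP]]]] := perturbed_solution hf xab psic dpsic psiK dpsiD ysol.
have subab s : s \in `]a, b[ -> s \in `[a, b] by exact: subset_itv_oo_cc.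
pose L := m%:R * N.
have L0 : 0 <= L by rewrite mulr_ge0.
pose E := 2 * expR ((L + 1) * (b - a)).
have E0 : 0 <= E by rewrite mulr_ge0// expR_ge0.
apply/cvgrPdist_le => eta eta0.
(* chosen so that the Gronwall bound below is at most eta *)
pose eps := eta / ((C + D + 1) * (E + 1)).
have eps0 : 0 < eps by rewrite divr_gt0// mulr_gt0// ltr_wpDl// addr_ge0.
have epsE : eps * (C + D) * E <= eta.
  have CD : 0 <= C + D by rewrite addr_ge0.
  rewrite /eps -mulrA mulrAC ler_pdivrMr; last by rewrite mulr_gt0// ltr_wpDl.
  by rewrite ler_wpM2l ?(ltW eta0)// ler_pM// lerDl.
have [rho rho0 rhoP] := uniform_linearization hf a b ycT psic eps0.
near=> e.
have e0 : e != 0 by near: e; exact: nbhs_dnbhs_neq.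
have ed : `|e| <= d by near: e; exact: dnbhs0_le.
have [[Yc Yd] Yxi] : solves f a b (fun t => psi t + e *: dpsi t) (Y e) /\ Y e xi = y xi.
  by near: e.
have : `|e| <= rho / (C + D + 1).
  by near: e; apply: dnbhs0_le; rewrite divr_gt0// ltr_wpDl// addr_ge0.
rewrite ler_pdivlMr ?ltr_wpDl ?addr_ge0// => erho.
have eC : C * `|e| <= rho.
  by apply: le_trans erho; rewrite mulrC ler_wpM2l// -addrA lerDl addr_ge0.
have eD : `|e| * D <= rho.
  by apply: le_trans erho; rewrite ler_wpM2l// addrAC lerDr addr_ge0.
have [z [zxi zd zy]] := dP e ed.
have psiec : {within `[a, b], continuous (fun t => psi t + e *: dpsi t)}.
  apply: continuous_subspaceT => s; apply: cvgD (psic s) _.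
  by apply: cvgZr; exact: dpsic.
have zsol : solves f a b (fun t => psi t + e *: dpsi t) z.
  split; last by move=> s /subab /zd.
  apply: continuous_in_subspaceT => s; rewrite inE => sab.
  exact: is_derive_cts (zd s sab).
have Yz s : s \in `[a, b] -> Y e s = z s.
  apply: (solution_unique hf xab psiec) => //.
  by rewrite Yxi zxi.
have Yy s : s \in `[a, b] -> `|Y e s - y s| <= C * `|e|.
  by move=> sab; rewrite Yz// zy.
pose w s := e^-1 *: (Y e s - y s) - delta s.
pose dw s := e^-1 *: (f (Y e s) (psi s + e *: dpsi s) - f (y s) (psi s))
  - (F1 f (y s) (psi s) *m delta s + F2 f (y s) (psi s) *m dpsi s).
have wc : {within `[a, b], continuous w}.
  move=> s; apply: cvgB (deltac s); apply: cvgZr.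
  exact: cvgB (Yc s) (yc s).
have wd s : s \in `]a, b[ -> is_derive s (1 : R) w (dw s).
  move=> sab.
  exact: is_deriveB (is_deriveZ e^-1 (is_deriveB (Yd s sab) (yd s sab))) (deltad s sab).
have c0 : 0 <= eps * (C + D) by rewrite mulr_ge0 ?addr_ge0// ltW.
have dle s i j : s \in `]a, b[ -> `|dw s i j| <= L * `|w s| + eps * (C + D).
  move=> /subab sab; rewrite ord1.
  have k_rho : `|e *: dpsi s| <= rho.
    by rewrite normrZ (le_trans _ eD)// ler_wpM2l.
  have h_rho : `|Y e s - y s| <= rho by apply: le_trans (Yy s sab) eC.
  have := rhoP s (Y e s - y s) (e *: dpsi s) i sab h_rho k_rho.
  rewrite [y s + _]addrC subrK.
  set r := (_ - _ - _); move=> rle.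
  have -> : dw s = F1 f (y s) (psi s) *m w s + e^-1 *: r.
    exact: difference_quotient_linearization.
  rewrite mxE (le_trans (ler_normD _ _))// lerD//; first by rewrite mulmx_entry_le.
  rewrite mxE normrM normfV ler_pdivrMl ?normr_gt0//.
  apply: le_trans rle _; rewrite mulrCA ler_wpM2l//; first exact: ltW.
  rewrite mulrDr lerD//; first by rewrite mulrC Yy.
  by rewrite normrZ ler_wpM2l.
have w0 : w xi = 0 by rewrite /w Yxi subrr scaler0 delta0 subrr.
have := gronwall L0 c0 xab wc wd dle w0 tab.
by rewrite distrC => /le_trans; apply.
Unshelve. all: by end_near.
Qed.

End Variation.

(** * Integrals over windows *)

Section Windows.
Context {R : realType}.
Notation mu := (@lebesgue_measure R).

Lemma Rintegral_FTC (h H : R -> R) (c d : R) : continuous h ->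
  (forall z, is_derive z (1 : R) H (h z)) -> c <= d ->
  \int[mu]_(z in `[c, d]) h z = H d - H c.
Proof.
move=> hc Hd; rewrite le_eqVlt => /predU1P[->|cd].
  by rewrite set_itv1 Rintegral_set1 subrr.
have Hc : continuous H by move=> z; exact: is_derive_cts (Hd z).
rewrite /Rintegral (@continuous_FTC2 R h H c d cd) //.
- exact: continuous_subspaceT.
- split.
  + by move=> z _; case: (Hd z).
  + exact: cvg_at_right_filter (Hc c).
  + exact: cvg_at_left_filter (Hc d).
- by move=> z _; rewrite derive1E; case: (Hd z).
Qed.

Lemma measurable_window (c d : R) :
  measurable_fun setT (fun z : measurableTypeR R => (c < z) && (z <= d)).
Proof.
apply: measurable_and.
  by apply: measurable_fun_ltr => //; exact: measurable_cst.
by apply: measurable_fun_ler => //; exact: measurable_cst.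
Qed.

(** The window may reach the endpoint q, which the domain of integration excludes;
    endpoints have measure zero. *)
Lemma Rintegral_window (h H : R -> R) (p q c d : R) : continuous h ->
  (forall z, is_derive z (1 : R) H (h z)) -> p <= c -> c <= d -> d <= q ->
  \int[mu]_(z in `[p, q[) (if (c < z) && (z <= d) then h z else 0) = H d - H c.
Proof.
move=> hc Hd pc cd dq.
have intcd : mu.-integrable `[c, d] (EFin \o h).
  apply: continuous_compact_integrable; first exact: segment_compact.
  exact: continuous_subspaceT.
have sub (i : interval R) : [set` i] `<=` `[c, d] -> mu.-integrable [set` i] (EFin \o h).
  by move=> icd; apply: (@integrableS _ _ _ mu _ _ _ _ _ icd intcd); exact: measurable_itv.
transitivity (\int[mu]_(z in `[p, q[ `&` `]c, d]) h z).
  rewrite Rintegral_mkcondr; apply: eq_Rintegral => z _.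
  by rewrite patchE mem_setE in_itv.
rewrite -(Rintegral_FTC hc Hd cd).
have [dq'|qd] := ltP d q.
  rewrite (_ : _ `&` _ = `]c, d]%classic).
    by rewrite Rintegral_itv_obnd_cbnd//; apply: sub; exact: subset_itv_oc_cc.
  apply/seteqP; split=> [z []//|z /=]; rewrite !in_itv/= => /andP[cz zd].
  by rewrite cz zd (le_trans pc (ltW cz)) (le_lt_trans zd dq').
have -> : q = d by apply/eqP; rewrite eq_le qd dq.
rewrite (_ : _ `&` _ = `]c, d[%classic).
  rewrite Rintegral_itv_bndo_bndc ?Rintegral_itv_obnd_cbnd//; apply: sub.
    exact: subset_itv_oc_cc.
  exact: subset_itv_oo_cc.
apply/seteqP; split=> z /=; rewrite !in_itv/=.
  by move=> [/andP[_ ->] /andP[-> _]].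
by move=> /andP[cz zd]; rewrite cz zd (ltW zd) (le_trans pc (ltW cz)).
Qed.

(** At a fixed time the regular part of the kernel is made of such a function. *)
Lemma measurable_two_windows (c d c' d' : R) (g1 g2 : R -> R) :
  continuous g1 -> continuous g2 ->
  measurable_fun setT (fun z : R => if (c < z) && (z <= d) then g1 z
    else if (c' < z) && (z <= d') then g2 z else 0).
Proof.
move=> g1c g2c; apply: measurable_fun_ifT; first exact: measurable_window.
  exact: continuous_measurable_fun.
apply: measurable_fun_ifT; first exact: measurable_window.
  exact: continuous_measurable_fun.
exact: measurable_cst.
Qed.

Lemma integrable_two_windows (p q c d c' d' : R) (g1 g2 : R -> R) :
  continuous g1 -> continuous g2 ->
  mu.-integrable `[p, q[ (fun z : R => (if (c < z) && (z <= d) then g1 z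
    else if (c' < z) && (z <= d') then g2 z else 0)%:E).
Proof.
move=> g1c g2c.
have [B1 B10 B1P] := within_itv_bounded (a := p) (b := q) (continuous_subspaceT g1c).
have [B2 B20 B2P] := within_itv_bounded (a := p) (b := q) (continuous_subspaceT g2c).
apply: (@measurable_bounded_integrable _ _ _ mu).
- exact: measurable_itv.
- by rewrite /= lebesgue_measure_itv/=; case: ifP => // _; rewrite -EFinB ltry.
- apply: measurable_funS (measurable_two_windows _ _ _ _ g1c g2c) => //.
- exists (B1 + B2); split; first exact: num_real.
  move=> x Bx z /= /subset_itv_co_cc zpq.
  have := B1P z zpq; have := B2P z zpq; case: ifP => _; last case: ifP => _;
    rewrite ?normr0; lra.
Qed.

Lemma integrable_dirac_threshold (p q c c' u t : R) :
  (\d_t : measure _ _).-integrable `[p, q[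
     (fun z : R => (if (c < z) && (c' < z) then u else 0)%:E).
Proof.
apply: measurable_bounded_integrable.
- exact: measurable_itv.
- by rewrite /= diracE; case: (_ \in _); rewrite ltry.
- have : measurable_fun setT (fun z : R => if (c < z) && (c' < z) then u else 0).
    apply: measurable_fun_ifT; [|exact: measurable_cst|exact: measurable_cst].
    by apply: measurable_and; apply: measurable_fun_ltr => //; exact: measurable_cst.
  exact: measurable_funS.
- exists `|u|; split; first exact: num_real.
  by move=> x ux z _ /=; case: ifP => _; rewrite ?normr0 ltW// (le_lt_trans _ ux).
Qed.

End Windows.

(** * The kernel and its pairing with a perturbation *)

Section Kernel.
Context {R : realType} {m : nat}.
Notation mu := (@lebesgue_measure R).
Notation V := 'cV[R]_m.
Variables (t0 tau xi : R) (M : R -> R -> 'M[R]_m).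

(** The matrix M t z is the response at time t to an impulse of the history at time
    z, which enters the equation at time z + tau. Since the value at xi is
    prescribed, the response at t integrates over the times z between xi - tau and
    t - tau, with the opposite sign when t < xi. The point masses at t >= t0 lie
    outside the domain of integration and contribute nothing: they record that the
    impulse at z has no effect before z + tau. *)
Definition variation_kernel : genkernel R m := fun t z =>
  if t0 <= t then
    if xi - tau < z then
      if z <= t - tau then regular (M t z) else delta_id R m
    else if t - tau < z then regular (- M t z) else regular 0
  else delta_id R m.

Local Notation K := variation_kernel.

Lemma regular_part_kernel t z : t0 <= t ->
  regular_part (K t z) = if (xi - tau < z) && (z <= t - tau) then M t z
    else if (t - tau < z) && (z <= xi - tau) then - M t z else 0.
Proof.
by rewrite /variation_kernel => ->; case: (ltP (xi - tau) z); case: (ltP (t - tau) z).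
Qed.

Lemma delta_part_kernel t z : t0 <= t ->
  delta_part (K t z) = if (xi - tau < z) && (t - tau < z) then 1%:M else 0.
Proof.
by rewrite /variation_kernel => ->; case: (ltP (xi - tau) z); case: (ltP (t - tau) z).
Qed.

Lemma kernel_past t z : t < t0 -> K t z = delta_id R m.
Proof. by rewrite /variation_kernel leNgt => ->. Qed.

Lemma variation_kernel_integrable t : continuous (M t) ->
  integrable_kernel K (t0 - tau) t0 t.
Proof.
move=> Mc i j.
have Mij : continuous (fun z => M t z i j) by move=> z; exact: cvg_entry (Mc z).
have NMij : continuous (fun z => - M t z i j) by move=> z; exact: cvgN (Mij z).
have cst0 : continuous (fun z : R => 0 : R) by move=> z; exact: cvg_cst.
have [tt0|tt0] := leP t0 t; split.
- have := integrable_two_windows (t0 - tau) t0 (xi - tau) (t - tau) (t - tau)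
    (xi - tau) Mij NMij.
  apply: eq_integrable => [|z _]; first exact: measurable_itv.
  rewrite regular_part_kernel//; congr (_%:E).
  by case: ifP => // _; case: ifP => _; rewrite mxE.
- have := integrable_dirac_threshold (t0 - tau) t0 (xi - tau) (t - tau)
    ((1%:M : 'M[R]_m) i j) t.
  apply: eq_integrable => [|z _]; first exact: measurable_itv.
  by rewrite delta_part_kernel//; case: ifP => // _; rewrite mxE.
- have := integrable_two_windows (t0 - tau) t0 0 0 0 0 cst0 cst0.
  apply: eq_integrable => [|z _]; first exact: measurable_itv.
  by rewrite kernel_past//= mxE !if_same.
- have := integrable_dirac_threshold (t0 - tau) t0 (t0 - tau - 1) (t0 - tau - 1)
    ((1%:M : 'M[R]_m) i j) t.
  apply: eq_integrable => [|z]; first exact: measurable_itv.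
  rewrite inE/= in_itv/= => /andP[z1 _].
  by rewrite kernel_past//= andbb ifT//; lra.
Qed.

(** Before t0 the solution is the history itself, and the kernel is a unit point
    mass. *)
Lemma pairing_past (v : R -> V) t : 0 < tau -> {within `[t0 - tau, t0], continuous v} ->
  t \in `[t0 - tau, t0[ -> pairing K (t0 - tau) t0 t v = v t.
Proof.
move=> tau0 vc tI; apply/matrixP => i j; rewrite ord1 mxE.
have tt0 : t < t0 by move: tI; rewrite in_itv/= => /andP[].
have st : t0 - tau <= t0 by rewrite gerBl ltW.
pose w z := v (clamp (t0 - tau) t0 z) i 0.
have wc : continuous w.
  move=> z; have cc := @continuous_clamp _ _ _ _ _ st vc z.
  exact: (@cvg_entry _ _ _ _ _ _ (v \o clamp (t0 - tau) t0) _ i 0 cc).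
have wE z : z \in `[t0 - tau, t0[ -> w z = v z i 0.
  by move=> /subset_itv_co_cc zI; rewrite /w clamp_id.
rewrite (_ : \int[mu]_(z in _) _ = 0) ?add0r; last first.
  rewrite (@eq_Rintegral _ _ _ _ _ (fun=> 0)) => [|z _].
    by rewrite /Rintegral integral0.
  by rewrite kernel_past//= mul0mx mxE.
rewrite (@eq_Rintegral _ _ _ _ _ w) => [|z]; last first.
  by rewrite inE/= => zI; rewrite kernel_past//= mul1mx wE.
rewrite /Rintegral integral_dirac; first last.
- apply/measurable_EFinP; apply: measurable_funS (continuous_measurable_fun wc) => //.
- exact: measurable_itv.
by rewrite diracE mem_set// mul1e /= wE.
Qed.

(** By the fundamental theorem of calculus; the signs in the kernel make the
    formula the same on both sides of xi. *)
Lemma pairing_future (v w H : R -> V) t :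
  t \in `[t0, t0 + tau] -> xi \in `[t0, t0 + tau] -> continuous (M t) ->
  continuous w -> (forall z, z \in `[t0 - tau, t0[ -> v z = w z) ->
  (forall z, is_derive z (1 : R) H (M t z *m w z)) ->
  pairing K (t0 - tau) t0 t v = H (t - tau) - H (xi - tau).
Proof.
rewrite !in_itv/= => /andP[tt0 t1] /andP[xi0 xi1] Mc wc vw Hd.
apply/matrixP => i j; rewrite ord1 [LHS]mxE.
pose h z := (M t z *m w z) i 0.
have hc : continuous h.
  by move=> z; apply: cvg_entry; exact: cvg_mulmx (Mc z) (wc z).
have Hid z : is_derive z (1 : R) (fun z => H z i 0) (h z).
  by have /is_derive_mxP := Hd z.
(* the point mass sits at t, outside the domain of integration *)
rewrite [X in _ + X](_ : _ = 0) ?addr0; last first.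
  pose g z := if (xi - tau < z) && (t - tau < z) then w z i 0 else 0.
  have gm : measurable_fun setT (g : R -> R).
    apply: measurable_fun_ifT; [|apply: continuous_measurable_fun|exact: measurable_cst].
      by apply: measurable_and; apply: measurable_fun_ltr => //; exact: measurable_cst.
    by move=> z; exact: cvg_entry (wc z).
  rewrite (@eq_Rintegral _ _ _ _ _ g) => [|z]; last first.
    rewrite inE/= => zI; rewrite delta_part_kernel// /g; case: ifP => _.
      by rewrite mul1mx vw.
    by rewrite mul0mx mxE.
  rewrite /Rintegral integral_dirac; first last.
  - by apply/measurable_EFinP; apply: measurable_funS gm.
  - exact: measurable_itv.
  rewrite diracE memNset ?mul0e// /= in_itv/= => /andP[_].
  by rewrite ltNge tt0.
have [xt|tx] := leP xi t.
  pose hw (z : R) := if (xi - tau < z) && (z <= t - tau) then h z else 0.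
  rewrite (@eq_Rintegral _ _ R mu _ hw) => [|z]; last first.
    rewrite inE/= => zI; rewrite regular_part_kernel// vw// /hw /h; case: ifP => // _.
    case: ifP => [/andP[z1 z2]|_]; last by rewrite mul0mx mxE.
    by exfalso; lra.
  by rewrite (Rintegral_window hc Hid) ?mxE//; lra.
have hNc : continuous (fun z => - h z) by move=> z; exact: cvgN (hc z).
have HNd z : is_derive z (1 : R) (fun z => - H z i 0) (- h z).
  exact: is_deriveN.
pose hw (z : R) := if (t - tau < z) && (z <= xi - tau) then - h z else 0.
rewrite (@eq_Rintegral _ _ R mu _ hw) => [|z]; last first.
  rewrite inE/= => zI; rewrite regular_part_kernel// vw// /hw /h.
  case: ifP => [/andP[z1 z2]|_]; first by rewrite ifF//; lra.
  by case: ifP => _; rewrite ?mul0mx ?mulNmx mxE.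
rewrite (Rintegral_window hNc HNd) ?mxE ?opprK 1?addrC//; lra.
Qed.

End Kernel.

(** * The functional derivative *)

Section Auxiliary.
Context {R : realType}.

Lemma mx_primitive_exists p q (xi : R) (h : R -> 'M[R]_(p, q)) : continuous h ->
  exists H : R -> 'M[R]_(p, q),
    H xi = 0 /\ forall t, is_derive t (1 : R) H (h t).
Proof.
move=> hc.
have /choice[H HP] : forall ij : 'I_p * 'I_q, exists H : R -> R,
    H xi = 0 /\ forall t : R, is_derive t 1 H (h t ij.1 ij.2).
  move=> [i j]; apply: primitive_exists => t; exact: cvg_entry (hc t).
exists (fun t => \matrix_(i, j) H (i, j) t); split.
  by apply/matrixP => i j; rewrite !mxE; have [] := HP (i, j).
move=> t; apply/is_derive_mxP => i j.
have := (HP (i, j)).2 t; congr is_derive.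
by apply/funext => s; rewrite mxE.
Qed.

Lemma is_derive_shift_arg p q (u : R -> 'M[R]_(p, q)) (c t : R) l :
  is_derive (t + c) (1 : R) u l -> is_derive t (1 : R) (fun s => u (s + c)) l.
Proof.
move=> /is_derive_mxP ul; apply/is_derive_mxP => i j.
have := @is_derive1_comp R (fun s => u s i j) (fun s => s + c) t _ _ (ul i j)
  (is_derive_shift t 1 c).
by rewrite mulr1.
Qed.

Lemma is_solution_solves m (f : 'cV[R]_m -> 'cV[R]_m -> 'cV[R]_m)
    (t0 tau xi : R) (eta : 'cV[R]_m) (phi psi u : R -> 'cV[R]_m) :
  (forall t, t \in `[t0, t0 + tau] -> psi t = phi (t - tau)) ->
  is_solution f t0 tau xi eta phi u -> solves f t0 (t0 + tau) psi u.
Proof.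
move=> psiE [ud _ _]; split.
  by apply/subspace_continuousP => t tI; exact: is_derive_within_continuous (ud t tI).
move=> t tI; have tI' := subset_itv_oo_cc tI.
by rewrite psiE//; apply: is_derive_within_itv tI _; exact: ud.
Qed.

End Auxiliary.

Unset Implicit Arguments.
Set Strict Implicit.
Set Printing Implicit Defensive.

Theorem theorem15 (R : realType) (m : nat)
  (f : 'cV[R]_m -> 'cV[R]_m -> 'cV[R]_m) (hf : C1 f)
  (t0 tau xi : R) (htau : 0 < tau) (hxi : xi \in `[t0, t0 + tau])
  (eta : 'cV[R]_m)
  (phi : R -> 'cV[R]_m) (hphi : {within `[t0 - tau, t0], continuous phi})
  (y : R -> 'cV[R]_m) (hy : is_solution f t0 tau xi eta phi y) :
  exists K : genkernel R m,
    is_functional_derivative f t0 tau xi eta phi y K /\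
    forall that : R, that \in `]xi - tau, t0[ ->
      exists Psi : R -> genval R m,
        is_Psi f t0 tau phi y that Psi /\
        forall t : R, t \in `[t0 - tau, t0 + tau] -> K t that = Psi t.
Proof.
have st : t0 - tau <= t0 by rewrite gerBl ltW.
have ab : t0 <= t0 + tau by rewrite lerDl ltW.
have [_ yxi yphi] := hy.
(* the data are extended to continuous functions on the whole line *)
pose shifted (u : R -> 'cV[R]_m) (s : R) := u (clamp (t0 - tau) t0 (s - tau)).
have shiftedE u t : t \in `[t0, t0 + tau] -> shifted u t = u (t - tau).
  rewrite in_itv/= => /andP[t1 t2]; rewrite /shifted clamp_id// in_itv/=; lra.
have sub_tau_c : continuous (fun s : R => s - tau).
  by move=> s; apply: cvgB; [exact: cvg_id|exact: cvg_cst].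
have add_tau_c : continuous (fun s : R => s + tau).
  by move=> s; apply: cvgD; [exact: cvg_id|exact: cvg_cst].
have shiftedc u : {within `[t0 - tau, t0], continuous u} -> continuous (shifted u).
  move=> uc s.
  exact: (cvg_comp _ _ (sub_tau_c s) (@continuous_clamp _ _ _ _ _ st uc (s - tau))).
have shiftedM u : {within `[t0 - tau, t0], continuous u} ->
    exists D, forall t, `|shifted u t| <= D.
  move=> /within_itv_bounded[D _ DP]; exists D => t.
  by apply: DP; exact: clamp_in.
pose psi := shifted phi.
have psic : continuous psi := shiftedc _ hphi.
have [Kpsi psiK] := shiftedM _ hphi.
have ysol0 : solves f t0 (t0 + tau) psi y.
  by apply: is_solution_solves hy; exact: shiftedE.
pose yy := y \o clamp t0 (t0 + tau).
have yyE t : t \in `[t0, t0 + tau] -> yy t = y t.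
  by move=> tI; rewrite /yy /= clamp_id.
have yyc : continuous yy by apply: continuous_clamp => //; exact: ysol0.1.
have [Ky Ky0 yK] := within_itv_bounded ysol0.1.
have yyK t : `|yy t| <= Ky by apply: yK; exact: clamp_in.
have yysol : solves f t0 (t0 + tau) psi yy.
  split; first exact: continuous_subspaceT.
  move=> t tI; rewrite yyE; last exact: subset_itv_oo_cc.
  apply: near_eq_is_derive (ysol0.2 t tI).
  have := near_in_itvoo tI; apply: filterS => s sI.
  by rewrite yyE//; exact: subset_itv_oo_cc.
have yyxi : yy xi = eta by rewrite yyE.
(* coefficients of the variational equation along y *)
pose A t := F1 f (yy t) (psi t); pose B t := F2 f (yy t) (psi t).
have [_ F1c F2c] := hf.
have pairc : continuous (fun t => (yy t, psi t)).
  by move=> t; exact: cvg_pair (yyc t) (psic t).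
have Ac : continuous A.
  by move=> t; exact: (cvg_comp _ _ (pairc t) (F1c (yy t, psi t))).
have Bc : continuous B.
  by move=> t; exact: (cvg_comp _ _ (pairc t) (F2c (yy t, psi t))).
have [N N0 AN] : exists2 N : R, 0 <= N & forall t i j, `|A t i j| <= N.
  have [N N0 NP] := continuous_bounded_box (Num.max Ky Kpsi) F1c.
  exists N => // t i j; apply: le_trans (mx_norm_entry _ _ _) _.
  by apply: (NP (yy t, psi t)); rewrite /box/= le_max ?yyK ?psiK ?orbT.
have [X [Y [Xxi Xd Yd XY]]] := fundamental_matrix xi Ac N0 AN.
have Xc : continuous X by move=> t; exact: is_derive_cts (Xd t).
have Yc : continuous Y by move=> t; exact: is_derive_cts (Yd t).
pose M t z := X t *m (Y (z + tau) *m B (z + tau)).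
have Mc t : continuous (M t).
  move=> z; apply: cvg_mulmx; first exact: cvg_cst.
  apply: cvg_mulmx.
    exact: (cvg_comp _ _ (add_tau_c z) (Yc (z + tau))).
  exact: (cvg_comp _ _ (add_tau_c z) (Bc (z + tau))).
exists (variation_kernel t0 tau xi M); split; first split.
- by move=> t _; exact: (variation_kernel_integrable _ _ _ (Mc t)).
- move=> dphi dphic; pose dpsi := shifted dphi.
  have dpsic : continuous dpsi := shiftedc _ dphic.
  have [D dpsiD] := shiftedM _ dphic.
  have psieE e t : t \in `[t0, t0 + tau] ->
      psi t + e *: dpsi t = phi (t - tau) + e *: dphi (t - tau).
    by move=> tI; rewrite /psi /dpsi !shiftedE.
  split.
    have [C [_ [d [d0 dP]]]] := perturbed_solution hf hxi psic dpsic psiK dpsiD yysol.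
    near=> e.
    have ed : `|e| <= d by near: e; exact: dnbhs0_le.
    have [z [zxi zd _]] := dP e ed.
    (* before t0 the solution must be the perturbed history *)
    pose z' t := if t \in `[t0 - tau, t0[ then phi t + e *: dphi t else z t.
    have z'E t : t \in `[t0, t0 + tau] -> z' t = z t.
      rewrite in_itv/= => /andP[tt0 _].
      by rewrite /z' in_itv/= [t < t0]ltNge tt0 andbF.
    exists z'; split; [|by rewrite z'E// zxi|by move=> t tI; rewrite /z' tI].
    move=> t tI; rewrite z'E// -psieE//.
    apply: (@eq_is_derive_within _ _ _ z) => //.
      by move=> s; rewrite inE/= => sI; rewrite z'E.
    by apply: is_derive_is_within; exact: zd.
  move=> Z Zsol t tI.
  have [tt0|tt0] := ltP t t0.
    have tI' : t \in `[t0 - tau, t0[.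
      by move: tI; rewrite !in_itv/= => /andP[-> _].
    rewrite pairing_past//.
    apply: cvg_near_cst; near=> e.
    have e0 : e != 0 by near: e; exact: nbhs_dnbhs_neq.
    have [_ _ Zphi] : is_solution f t0 tau xi eta (fun s => phi s + e *: dphi s) (Z e).
      by near: e.
    by rewrite Zphi// yphi// addrAC subrr add0r scalerA mulVf// scale1r.
  have tI' : t \in `[t0, t0 + tau].
    by move: tI; rewrite !in_itv/= tt0 => /andP[_ ->].
  (* variation of constants *)
  have hc : continuous (fun s => Y s *m (B s *m dpsi s)).
    move=> s; apply: cvg_mulmx (Yc s) _; exact: cvg_mulmx (Bc s) (dpsic s).
  have [G [Gxi Gd]] := mx_primitive_exists xi hc.
  pose delta s := X s *m G s.
  have deltad s : is_derive s (1 : R) delta (A s *m delta s + B s *m dpsi s).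
    apply: is_derive_eq; first exact: is_derive_mulmx (Xd s) (Gd s).
    by rewrite /delta -mulmxA [X s *m (Y s *m _)]mulmxA XY mul1mx.
  have -> : pairing (variation_kernel t0 tau xi M) (t0 - tau) t0 t dphi = delta t.
    (* in the variable z = s - tau the variation of constants formula is the
       integral of the kernel against dphi *)
    pose w z := dphi (clamp (t0 - tau) t0 z).
    have wc : continuous w := @continuous_clamp _ _ _ _ _ st dphic.
    have Hd z : is_derive z (1 : R) (fun z => X t *m G (z + tau)) (M t z *m w z).
      have := is_derive_mulmx (is_derive_cst (X t) z 1)
        (is_derive_shift_arg (Gd (z + tau))).
      by rewrite mul0mx add0r /M /dpsi /shifted addrK !mulmxA.
    rewrite (pairing_future tI' hxi (Mc t) wc _ Hd).
      by rewrite !subrK Gxi mulmx0 subr0.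
    by move=> z /subset_itv_co_cc zI; rewrite /w clamp_id.
  have deltac : {within `[t0, t0 + tau], continuous delta}.
    by apply: continuous_subspaceT => s; exact: is_derive_cts (deltad s).
  have delta0 : delta xi = 0 by rewrite /delta Gxi mulmx0.
  have Zsolves : \forall e \near (0 : R)^',
      solves f t0 (t0 + tau) (fun s => psi s + e *: dpsi s) (Z e) /\ Z e xi = yy xi.
    near=> e.
    have Ze : is_solution f t0 tau xi eta (fun s => phi s + e *: dphi s) (Z e).
      by near: e.
    split; last by case: Ze => _ -> _.
    exact: is_solution_solves (psieE e) Ze.
  rewrite -(yyE t tI').
  exact: (solution_derivative hf hxi psic dpsic yyc psiK dpsiD N0 AN yysol
    deltac delta0 (fun s _ => deltad s) Zsolves tI').
(* in t, the kernel is a fundamental matrix times a constant matrix *)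
- move=> that thatI; exists (fun t => variation_kernel t0 tau xi M t that); split => //.
  move: thatI hxi; rewrite !in_itv/= => /andP[that1 that2] /andP[xi1 xi2].
  split; last first.
    move=> t; rewrite in_itv/= => /andP[t1 t2].
    rewrite /variation_kernel that1; case: leP => // tt0.
    by rewrite ifF//; lra.
  have sub t : t \in `[that + tau, t0 + tau] -> t \in `[t0, t0 + tau].
    by rewrite !in_itv/= => /andP[t1 ->]; rewrite andbT; lra.
  exists (M^~ that); split.
  + move=> t; rewrite in_itv/= => /andP[t1 t2].
    by rewrite /variation_kernel that1 !ifT//; lra.
  + apply: continuous_subspaceT => t.
    by apply: cvg_mulmx (Xc t) _; exact: cvg_cst.
  + move=> t /subset_itv_oc_cc /sub tI; apply: is_derive_is_within.
    rewrite -(yyE t tI) -(shiftedE phi t tI) -/psi -/(A t).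
    apply: is_derive_eq.
      exact: is_derive_mulmx (Xd t) (is_derive_cst (Y (that + tau) *m B (that + tau)) t 1).
    by rewrite mulmx0 addr0 /M mulmxA.
  + have tI : that + tau \in `[t0, t0 + tau].
      by apply: sub; rewrite in_itv/= lexx lerD2r ltW.
    have that_past : that \in `[t0 - tau, t0[.
      by rewrite in_itv/= that2 andbT; lra.
    have psiE : psi (that + tau) = y that.
      by rewrite /psi (shiftedE _ _ tI) addrK yphi.
    by rewrite /M mulmxA XY mul1mx /B psiE (yyE _ tI).
Unshelve. all: by end_near. Qed.
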